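(* Let $R$ be a commutative ring and let $N\subseteq M$ be $R$-modules such that $M/N$ is finitely presented. Then the radical $\operatorname{rad}(N)$ of $N$ in $M$ equals the closure of $N$ in $M$ induced by the surjective topology on $\operatorname{Spec} R$. If $R$ is noetherian of finite dimension, then this is true for arbitrary $R$-submodules $N\subseteq M$.
   Context: For $R$-modules $N\subseteq M$ the radical of $N$ in $M$ is $$\operatorname{rad}(N)=\{s\in M:\ s\otimes 1\in\operatorname{im}(N\otimes_RK\to M\otimes_RK)\text{ for all ring homomorphisms }R\to K\text{ to a field }K\}.$$ Surjective topology on a scheme $X$: the category is the full subcategory of schemes (or of schemes of finite type) which are affine over $X$; the coverings are the single morphisms $V\to U$ over $X$ which are affine, surjective and of finite type. Closure induced by an affine Grothendieck topology on $X=\operatorname{Spec} R$: for an $R$-module $M$ let $M_{\mathrm{top}}$ be the sheafification of the presheaf $\operatorname{Spec} S\mapsto M\otimes_R S$ in the topology, with sheafification map $\theta:M\to\Gamma(X_{\mathrm{top}},M_{\mathrm{top}})$. For $N\subseteq M$ let $N^{\mathrm{top}}$ be the image sheaf of $N_{\mathrm{top}}\to M_{\mathrm{top}}$; the induced closure is $N^{\mathrm{top-cl}}:=\theta^{-1}(\Gamma(X_{\mathrm{top}},N^{\mathrm{top}}))\subseteq M$. *)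

(* Defs.v *)
From HB Require Import structures.
From mathcomp Require Import all_boot all_algebra.
From mathcomp Require Import freeg.
From mathcomp Require Import boolp.

Set Implicit Arguments.
Unset Strict Implicit.
Unset Printing Implicit Defensive.

Import GRing.Theory.
Local Open Scope ring_scope.
Local Open Scope quotient_scope.

(* Rings are [comPzRingType]s, so that the zero ring (the
   empty scheme) is not excluded. *)

Section Submodules.
Variables (R : comPzRingType) (M : lmodType R) (N : submodClosed M).

Record submod := Submod { submod_val : M; submod_valP : submod_val \in N }.

HB.instance Definition _ := [isSub for submod_val].
HB.instance Definition _ := [Choice of submod by <:].
HB.instance Definition _ := [SubChoice_isSubLmodule of submod by <:].

Definition submod_incl : {linear submod -> M} := val.

Definition submod_mem : {pred M} := fun x => x \in N.

Fact submod_mem_zmod : zmod_closed submod_mem.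
Proof.
split=> [|x y xN yN]; first exact: rpred0.
by apply: (rpredD (S := N)) => //; rewrite -scaleN1r; apply: rpredZ.
Qed.
HB.instance Definition _ := GRing.isZmodClosed.Build M submod_mem submod_mem_zmod.

(* M / N, with the scaling added below to MathComp's additive quotient. *)
Definition quotmod := Quotient.quot submod_mem.
HB.instance Definition _ := GRing.Zmodule.on quotmod.

Definition quotmod_pi (x : M) : quotmod := \pi_(Quotient.quot submod_mem) x.
Definition quotmod_scale (a : R) (u : quotmod) : quotmod :=
  quotmod_pi (a *: repr (u : Quotient.quot submod_mem)).

Fact quotmod_pi_eq x y : quotmod_pi x = quotmod_pi y <-> x - y \in N.
Proof.
rewrite -[x - y \in N]/(x - y \in submod_mem) Quotient.idealrBE.
by split=> [h|/eqP h]; [apply/eqP | ].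
Qed.

Fact quotmod_piD : {morph quotmod_pi : x y / x + y}.
Proof. by move=> x y; apply: (raddfD \pi_(Quotient.quot submod_mem)). Qed.

Fact quotmod_reprK (u : quotmod) :
  quotmod_pi (repr (u : Quotient.quot submod_mem)) = u.
Proof. exact: reprK. Qed.

Fact quotmod_piZ a x : quotmod_scale a (quotmod_pi x) = quotmod_pi (a *: x).
Proof.
apply/quotmod_pi_eq; rewrite -scalerBr; apply: rpredZ.
exact/quotmod_pi_eq/quotmod_reprK.
Qed.

Fact quotmod_scaleA a b u :
  quotmod_scale a (quotmod_scale b u) = quotmod_scale (a * b) u.
Proof. by rewrite -[u]quotmod_reprK !quotmod_piZ scalerA. Qed.

Fact quotmod_scale1 : left_id 1 quotmod_scale.
Proof. by move=> u; rewrite -[u]quotmod_reprK quotmod_piZ scale1r. Qed.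

Fact quotmod_scaleDr : right_distributive quotmod_scale +%R.
Proof.
move=> a u v; rewrite -[u]quotmod_reprK -[v]quotmod_reprK -quotmod_piD.
by rewrite !quotmod_piZ scalerDr quotmod_piD.
Qed.

Fact quotmod_scaleDl u : {morph quotmod_scale^~ u : a b / a + b}.
Proof.
move=> a b; rewrite -[u]quotmod_reprK !quotmod_piZ.
by rewrite scalerDl quotmod_piD.
Qed.

HB.instance Definition _ := GRing.Zmodule_isLmodule.Build R quotmod
  quotmod_scaleA quotmod_scale1 quotmod_scaleDr quotmod_scaleDl.

End Submodules.

(* An exact sequence R^m -> R^n -> Q -> 0, with row vectors. *)
Definition finitely_presented (R : comPzRingType) (Q : lmodType R) : Prop :=
  exists (m n : nat) (A : 'M[R]_(m, n)) (p : {linear 'rV[R]_n -> Q}),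
    (forall q, exists v, p v = q) /\
    (forall v, p v = 0 <-> exists u : 'rV[R]_m, v = u *m A).

Fact freeg_ext (K : choiceType) (A : zmodType)
    (f g : {additive {freeg K / int} -> A}) :
  (forall k, f << k >> = g << k >>) -> f =1 g.
Proof.
move=> fg x; rewrite -[x]freeg_sumE !raddf_sum.
apply: eq_bigr => k _; set c := coeff _ _.
have -> : << c *g k >> = << k >> *~ c :> {freeg K / int}.
  apply/eqP/freeg_eqP => y; rewrite raddfMz /= !coeffU mul1r.
  by rewrite -mulrzl intz.
by rewrite !raddfMz fg.
Qed.

(* M (x)_R S, with S an R-module through [phi], as the free abelian group on
   M x S modulo the subgroup generated by the usual relators. *)
Section Tensor.
Variables (R : comPzRingType) (M : lmodType R).
Variables (S : comPzRingType) (phi : {rmorphism R -> S}).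

Local Notation gen m s := (<< (m, s) >> : {freeg (M * S)%type / int}).

Inductive tensor_relator : {freeg (M * S)%type / int} -> Prop :=
| TensorAddl m m' s : tensor_relator (gen (m + m') s - gen m s - gen m' s)
| TensorAddr m s s' : tensor_relator (gen m (s + s') - gen m s - gen m s')
| TensorBal a m s : tensor_relator (gen (a *: m) s - gen m (phi a * s)).

Definition tensor_null : {pred {freeg (M * S)%type / int}} := fun x =>
  `[< forall G : zmodClosed {freeg (M * S)%type / int},
        (forall y, tensor_relator y -> y \in G) -> x \in G >].

Fact tensor_null_zmod : zmod_closed tensor_null.
Proof.
split=> [|x y /asboolP xN /asboolP yN]; apply/asboolP => G GP.
  exact: rpred0.
by apply: rpredB; [apply: xN | apply: yN].
Qed.
HB.instance Definition _ :=
  GRing.isZmodClosed.Build _ tensor_null tensor_null_zmod.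

Definition tensor := Quotient.quot tensor_null.
HB.instance Definition _ := GRing.Zmodule.on tensor.

Definition tpure (m : M) (s : S) : tensor := \pi_(Quotient.quot tensor_null) (gen m s).

Record balanced (A : zmodType) (b : M -> S -> A) : Prop := Balanced {
  balancedDl : forall m m' s, b (m + m') s = b m s + b m' s;
  balancedDr : forall m s s', b m (s + s') = b m s + b m s';
  balancedZ : forall a m s, b (a *: m) s = b m (phi a * s) }.

(* The additive map induced by [b], which is meaningful when [b] is balanced. *)
Definition tlift (A : zmodType) (b : M -> S -> A) (z : tensor) : A :=
  fglift (fun x : M * S => (b x.1 x.2 : zmodule A))
         (repr (z : Quotient.quot tensor_null)).

Fact tpure_balanced : balanced tpure.
Proof.
have E u v : tensor_relator (u - v) ->
    \pi_(Quotient.quot tensor_null) u = \pi_(Quotient.quot tensor_null) v.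
  move=> h; apply/eqP; rewrite -Quotient.idealrBE; apply/asboolP => G; exact.
have piD u v : \pi_(Quotient.quot tensor_null) u + \pi_(Quotient.quot tensor_null) v
    = \pi_(Quotient.quot tensor_null) (u + v) :> tensor.
  by rewrite (raddfD \pi_(Quotient.quot tensor_null)).
split=> [m m' s|m s s'|a m s]; rewrite /tpure.
- by rewrite piD; apply: E; rewrite opprD addrA; exact: TensorAddl.
- by rewrite piD; apply: E; rewrite opprD addrA; exact: TensorAddr.
- by apply: E; exact: TensorBal.
Qed.

Section Lift.
Variables (A : zmodType) (b : M -> S -> A) (bP : balanced b).
Local Notation lft := (fglift (fun x : M * S => (b x.1 x.2 : zmodule A))).

Let lft_gen m s : lft (gen m s) = b m s.
Proof. by rewrite liftU scale1r. Qed.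

Let lftB : {morph lft : x y / x - y}.
Proof. exact: lift_is_additive. Qed.

Definition lft_ker : {pred {freeg (M * S)%type / int}} := fun x => lft x == 0.
Fact lft_ker_zmod : zmod_closed lft_ker.
Proof.
split=> [|x y /eqP xN /eqP yN]; apply/eqP.
  by rewrite -(subrr 0) lftB subrr.
by rewrite lftB xN yN subrr.
Qed.
HB.instance Definition _ := GRing.isZmodClosed.Build _ lft_ker lft_ker_zmod.

Let lft_null x : x \in tensor_null -> lft x = 0.
Proof.
move=> /asboolP h; apply/eqP; apply: (h lft_ker) => y; case=> *; apply/eqP;
  rewrite !lftB !lft_gen.
- by rewrite (balancedDl bP) addrAC addrK subrr.
- by rewrite (balancedDr bP) addrAC addrK subrr.
- by rewrite (balancedZ bP) subrr.
Qed.

Let tlift_pi x : tlift b (\pi_(Quotient.quot tensor_null) x) = lft x.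
Proof.
apply/eqP; rewrite -subr_eq0 -lftB; apply/eqP/lft_null.
by rewrite Quotient.idealrBE reprK.
Qed.

Fact tlift_pure m s : tlift b (tpure m s) = b m s.
Proof. by rewrite tlift_pi lft_gen. Qed.

Fact tlift_additive : {morph tlift b : x y / x - y}.
Proof.
move=> x y; rewrite -[x]reprK -[y]reprK.
by rewrite -(raddfB \pi_(Quotient.quot tensor_null)) !tlift_pi lftB.
Qed.
End Lift.

Fact tensor_ext (A : zmodType) (f g : tensor -> A) :
  {morph f : x y / x - y} -> {morph g : x y / x - y} ->
  (forall m s, f (tpure m s) = g (tpure m s)) -> f =1 g.
Proof.
move=> fB gB fg z; rewrite -[z]reprK; set x := repr _.
pose F u := f (\pi_(Quotient.quot tensor_null) u).
pose G u := g (\pi_(Quotient.quot tensor_null) u).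
have FB : {morph F : x y / x - y}.
  by move=> u v; rewrite /F -fB -(raddfB \pi_(Quotient.quot tensor_null)).
have GB : {morph G : x y / x - y}.
  by move=> u v; rewrite /G -gB -(raddfB \pi_(Quotient.quot tensor_null)).
pose aF := GRing.isZmodMorphism.Build _ _ F FB.
pose F' : {additive _ -> _} := HB.pack F aF.
pose aG := GRing.isZmodMorphism.Build _ _ G GB.
pose G' : {additive _ -> _} := HB.pack G aG.
by apply: (@freeg_ext _ _ F' G') => -[m s]; apply: fg.
Qed.

End Tensor.

Definition tensor_map (R : comPzRingType) (M M' : lmodType R)
    (S : comPzRingType) (phi : {rmorphism R -> S}) (f : {linear M -> M'}) :
  tensor M phi -> tensor M' phi := tlift (fun m s => tpure phi (f m) s).

Definition tensor_base_change (R : comPzRingType) (M : lmodType R)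
    (S T : comPzRingType) (phi : {rmorphism R -> S}) (psi : {rmorphism R -> T})
    (g : {rmorphism S -> T}) :
  tensor M phi -> tensor M psi := tlift (fun m s => tpure psi m (g s)).

Section TensorFunctoriality.
Variables (R : comPzRingType) (M M' : lmodType R).

Fact tensor_map_balanced (S : comPzRingType) (phi : {rmorphism R -> S})
    (f : {linear M -> M'}) : balanced phi (fun m s => tpure phi (f m) s).
Proof.
by split=> [m m' s|m s s'|a m s]; rewrite ?linearD ?linearZ;
  [apply: balancedDl | apply: balancedDr | apply: balancedZ];
  apply: tpure_balanced.
Qed.

Fact tensor_base_change_balanced (S T : comPzRingType)
    (phi : {rmorphism R -> S}) (psi : {rmorphism R -> T})
    (g : {rmorphism S -> T}) : (forall r, g (phi r) = psi r) ->
  balanced phi (fun (m : M) s => tpure psi m (g s)).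
Proof.
move=> gP; split=> [m m' s|m s s'|a m s]; rewrite ?rmorphD ?rmorphM ?gP;
  [apply: balancedDl | apply: balancedDr | apply: balancedZ];
  exact: tpure_balanced.
Qed.

End TensorFunctoriality.

Definition radical (R : comPzRingType) (M : lmodType R) (N : submodClosed M)
    (s : M) : Prop :=
  forall (K : fieldType) (phi : {rmorphism R -> K}),
    exists z : tensor (submod N) phi,
      tensor_map (submod_incl N) z = tpure phi s 1.

Record category := Category {
  ob :> Type;
  hom : ob -> ob -> Type;
  idm : forall U, hom U U;
  comp : forall U V W, hom V U -> hom W V -> hom W U;
  comp1m : forall U V (f : hom V U), comp (idm U) f = f;
  compm1 : forall U V (f : hom V U), comp f (idm V) = f;
  compA : forall U V W X (f : hom V U) (g : hom W V) (h : hom X W),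
    comp f (comp g h) = comp (comp f g) h }.
Arguments hom {c} _ _.
Arguments idm {c} _.

Record presheaf (C : category) := Presheaf {
  sec :> C -> Type;
  res : forall U V, hom V U -> sec U -> sec V;
  res1 : forall U (s : sec U), res (idm U) s = s;
  resM : forall U V W (f : hom V U) (g : hom W V) s,
    res (comp f g) s = res g (res f s) }.

Record presheaf_hom (C : category) (P Q : presheaf C) := PresheafHom {
  app :> forall U, P U -> Q U;
  app_res : forall U V (f : hom V U) s, app (res f s) = res f (app s) }.

Record sieve (C : category) (U : C) := Sieve {
  in_sieve :> forall V, hom V U -> Prop;
  sieve_comp : forall V W (f : hom V U) (g : hom W V),
    in_sieve f -> in_sieve (comp f g) }.
Arguments in_sieve {C U} D {V} f : rename.

Fact pull_comp (C : category) (U : C) (D : sieve U) V (h : hom V U)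
    W X (f : hom W V) (g : hom X W) :
  D _ (comp h f) -> D _ (comp h (comp f g)).
Proof. by rewrite compA; apply: sieve_comp. Qed.

Definition pull (C : category) (U : C) (D : sieve U) V (h : hom V U) : sieve V :=
  @Sieve C V (fun W f => D _ (comp h f)) (@pull_comp C U D V h).

Definition max_sieve (C : category) (U : C) : sieve U :=
  @Sieve C U (fun _ _ => True) (fun _ _ _ _ _ => I).

Definition sieveI (C : category) (U : C) (D D' : sieve U) : sieve U :=
  @Sieve C U (fun V f => D _ f /\ D' _ f)
    (fun V W f g h => conj (sieve_comp g h.1) (sieve_comp g h.2)).

(* The Grothendieck topology (as covering sieves) generated by the coverings
   [cov], each of which consists of a single morphism.  A sieve containing the
   identity is the maximal sieve. *)
Inductive covering (C : category) (cov : forall U V : C, hom V U -> Prop) :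
    forall U : C, sieve U -> Prop :=
| CoveringGen U V (f : hom V U) (D : sieve U) :
    cov U V f -> D _ f -> covering cov D
| CoveringMax U (D : sieve U) : D _ (idm U) -> covering cov D
| CoveringPull U V (h : hom V U) (D : sieve U) :
    covering cov D -> covering cov (pull D h)
| CoveringTrans U (D D' : sieve U) :
    covering cov D ->
    (forall V (f : hom V U), D _ f -> covering cov (pull D' f)) ->
    covering cov D'.

Section Quotients.
Variables (T : Type) (e : T -> T -> Prop).

(* The quotient of [T] by an equivalence relation, as a type of classes.  It
   is used for sections over a large site, which live in a universe too big
   for MathComp's quotient types. *)
Definition classes : Type := {A : T -> Prop | exists x, A = e x}.
Definition class_of (x : T) : classes := exist _ (e x) (ex_intro _ x erefl).
Definition class_repr (A : classes) : T := projT1 (cid (proj2_sig A)).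

Fact class_reprK A : class_of (class_repr A) = A.
Proof.
rewrite /class_repr; case: cid => x /=; case: A => A Ax /= eA.
by subst A; rewrite /class_of; congr exist; apply: Prop_irrelevance.
Qed.

Hypotheses (eR : forall x, e x x) (eS : forall x y, e x y -> e y x)
  (eT : forall x y z, e x y -> e y z -> e x z).

Fact class_of_eq x y : class_of x = class_of y <-> e x y.
Proof.
split=> [[h]|exy]; first by rewrite h; apply: eR.
have E : e x = e y.
  apply: functional_extensionality_dep => z; apply: propext; split=> h.
    exact: eT (eS exy) h.
  exact: eT exy h.
rewrite /class_of; move: (ex_intro _ y _) => p; move: (ex_intro _ x _) => q.
by move: q p; rewrite E => q p; congr exist; apply: Prop_irrelevance.
Qed.

Fact class_of_reprE x : e (class_repr (class_of x)) x.
Proof. exact/class_of_eq/class_reprK. Qed.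
End Quotients.

Section Plus.
Variables (C : category) (cov : forall U V : C, hom V U -> Prop).

Fact covering_sub U (D D' : sieve U) :
  (forall V (f : hom V U), D _ f -> D' _ f) ->
  covering cov D -> covering cov D'.
Proof.
move=> sDD' cD; apply: (CoveringTrans cD) => V f fD.
by apply: CoveringMax; rewrite /= compm1; apply: sDD'.
Qed.

Fact covering_sieveI U (D D' : sieve U) :
  covering cov D -> covering cov D' -> covering cov (sieveI D D').
Proof.
move=> cD cD'; apply: (CoveringTrans cD) => V f fD.
apply: covering_sub (CoveringPull f cD') => W g gD'; split=> //.
exact: sieve_comp.
Qed.

Section PlusObject.
Variable P : presheaf C.

Record local_section (U : C) := LocalSection {
  ls_dom : sieve U;
  ls_cov : covering cov ls_dom;
  ls_fam : forall V (f : hom V U), ls_dom _ f -> P V;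
  ls_matching : forall V W (f : hom V U) (g : hom W V)
      (fD : ls_dom _ f) (fgD : ls_dom _ (comp f g)),
    ls_fam fgD = res g (ls_fam fD) }.

Definition ls_eqv (U : C) (x y : local_section U) : Prop :=
  exists D : sieve U, covering cov D /\
    forall V (f : hom V U), D _ f ->
      exists (fx : ls_dom x _ f) (fy : ls_dom y _ f), ls_fam fx = ls_fam fy.

Fact ls_fam_irr U (x : local_section U) V (f g : hom V U)
    (fx : ls_dom x _ f) (gx : ls_dom x _ g) : f = g -> ls_fam fx = ls_fam gx.
Proof. by move=> E; subst g; congr ls_fam; apply: Prop_irrelevance. Qed.

Fact ls_eqv_refl U (x : local_section U) : ls_eqv x x.
Proof. by exists (ls_dom x); split=> [|V f fx]; [apply: ls_cov | exists fx, fx]. Qed.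

Fact ls_eqv_sym U (x y : local_section U) : ls_eqv x y -> ls_eqv y x.
Proof.
case=> D [cD DP]; exists D; split=> // V f /DP[fx [fy E]].
by exists fy, fx.
Qed.

Fact ls_eqv_trans U (x y z : local_section U) :
  ls_eqv x y -> ls_eqv y z -> ls_eqv x z.
Proof.
case=> D [cD DP] [D' [cD' D'P]]; exists (sieveI D D').
split=> [|V f [/DP[fx [fy E]] /D'P[fy' [fz E']]]]; first exact: covering_sieveI.
by exists fx, fz; rewrite E -E'; apply: ls_fam_irr.
Qed.

Definition plus_sec (U : C) : Type := classes (@ls_eqv U).

Fact ls_class_eq U (x y : local_section U) :
  class_of (@ls_eqv U) x = class_of (@ls_eqv U) y <-> ls_eqv x y.
Proof.
exact: class_of_eq (@ls_eqv_refl U) (@ls_eqv_sym U) (@ls_eqv_trans U) x y.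
Qed.

Section Restriction.
Variables (U V : C) (h : hom V U) (x : local_section U).

Definition ls_res_fam W (f : hom W V) (fD : pull (ls_dom x) h _ f) : P W :=
  ls_fam fD.

Fact ls_res_matching W X (f : hom W V) (g : hom X W)
    (fD : pull (ls_dom x) h _ f) (fgD : pull (ls_dom x) h _ (comp f g)) :
  ls_res_fam fgD = res g (ls_res_fam fD).
Proof.
rewrite /ls_res_fam; have gD := @sieve_comp _ _ (ls_dom x) _ _ (comp h f) g fD.
by rewrite -(ls_matching fD gD); apply: ls_fam_irr; rewrite compA.
Qed.

Definition ls_res : local_section V :=
  LocalSection (CoveringPull h (ls_cov x)) ls_res_matching.
End Restriction.

Fact ls_res_eqv U V (h : hom V U) (x y : local_section U) :
  ls_eqv x y -> ls_eqv (ls_res h x) (ls_res h y).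
Proof.
case=> D [cD DP]; exists (pull D h); split=> [|W f]; first exact: CoveringPull.
by move=> /DP[fx [fy E]]; exists fx, fy.
Qed.

Definition plus_res U V (h : hom V U) (s : plus_sec U) : plus_sec V :=
  class_of _ (ls_res h (class_repr s)).

Fact plus_res_class U V (h : hom V U) (x : local_section U) :
  plus_res h (class_of _ x) = class_of _ (ls_res h x).
Proof.
apply/ls_class_eq/ls_res_eqv; apply: class_of_reprE.
- exact: ls_eqv_refl. - exact: ls_eqv_sym. - exact: ls_eqv_trans.
Qed.

Fact plus_res1 U (s : plus_sec U) : plus_res (idm U) s = s.
Proof.
rewrite -[s]class_reprK plus_res_class; move: (class_repr s) => x.
apply/ls_class_eq; exists (ls_dom x); split=> [|V f fD]; first exact: ls_cov.
have fD' : pull (ls_dom x) (idm U) _ f by rewrite /= comp1m.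
by exists fD', fD; rewrite /= /ls_res_fam; apply: ls_fam_irr; rewrite comp1m.
Qed.

Fact plus_resM U V W (f : hom V U) (g : hom W V) (s : plus_sec U) :
  plus_res (comp f g) s = plus_res g (plus_res f s).
Proof.
rewrite -[s]class_reprK !plus_res_class; move: (class_repr s) => x.
apply/ls_class_eq; exists (pull (ls_dom x) (comp f g)).
split=> [|X h hD]; first exact/CoveringPull/ls_cov.
have hD' : pull (pull (ls_dom x) f) g _ h by rewrite /= compA.
by exists hD, hD'; rewrite /= /ls_res_fam; apply: ls_fam_irr; rewrite compA.
Qed.

(* The plus construction: sections over [U] are the elements of the colimit,
   over the covering sieves [D] of [U], of the sets of matching families of
   sections of [P] on [D]. *)
Definition plus : presheaf C := Presheaf plus_res1 plus_resM.

Section Unit.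
Variables (U : C) (s : P U).

Fact max_sieve_covering : covering cov (max_sieve U).
Proof. exact: CoveringMax. Qed.

Fact ls_unit_matching V W (f : hom V U) (g : hom W V)
    (fD : max_sieve U _ f) (fgD : max_sieve U _ (comp f g)) :
  res (comp f g) s = res g (res f s).
Proof. exact: resM. Qed.

Definition ls_unit : local_section U :=
  @LocalSection U (max_sieve U) max_sieve_covering
    (fun V f _ => res f s) ls_unit_matching.
End Unit.

Fact plus_unit_res U V (f : hom V U) (s : P U) :
  class_of _ (ls_unit (res f s)) = plus_res f (class_of _ (ls_unit s)).
Proof.
rewrite plus_res_class; apply/ls_class_eq; exists (max_sieve V).
split=> [|W g _]; first exact: max_sieve_covering.
by exists I, I; rewrite /= /ls_res_fam /= resM.
Qed.

Definition plus_unit : presheaf_hom P plus :=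
  @PresheafHom C P plus (fun U s => class_of _ (ls_unit s)) plus_unit_res.

End PlusObject.

Section PlusMap.
Variables (P Q : presheaf C) (a : presheaf_hom P Q).

Section LocalMap.
Variables (U : C) (x : local_section P U).

Fact ls_map_matching V W (f : hom V U) (g : hom W V)
    (fD : ls_dom x _ f) (fgD : ls_dom x _ (comp f g)) :
  a _ (ls_fam fgD) = res g (a _ (ls_fam fD)).
Proof. by rewrite (ls_matching fD) app_res. Qed.

Definition ls_map : local_section Q U :=
  @LocalSection Q U (ls_dom x) (ls_cov x)
    (fun V f fD => a _ (ls_fam fD)) ls_map_matching.
End LocalMap.

Fact ls_map_eqv U (x y : local_section P U) :
  ls_eqv x y -> ls_eqv (ls_map x) (ls_map y).
Proof.
case=> D [cD DP]; exists D; split=> // V f /DP[fx [fy E]].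
by exists fx, fy; rewrite /= E.
Qed.

Definition plus_map_app U (s : plus P U) : plus Q U :=
  class_of _ (ls_map (class_repr s)).

Fact plus_map_class U (x : local_section P U) :
  plus_map_app (class_of _ x : plus P U) = class_of _ (ls_map x).
Proof.
apply/ls_class_eq/ls_map_eqv; apply: class_of_reprE.
- exact: ls_eqv_refl. - exact: ls_eqv_sym. - exact: ls_eqv_trans.
Qed.

Fact plus_map_res U V (f : hom V U) (s : plus P U) :
  plus_map_app (res f s) = res f (plus_map_app s).
Proof.
rewrite -[s]class_reprK; move: (class_repr s) => x.
rewrite /= plus_res_class !plus_map_class plus_res_class.
apply/ls_class_eq; exists (pull (ls_dom x) f).
split=> [|W g gD]; first exact/CoveringPull/ls_cov.
by exists gD, gD.
Qed.

Definition plus_map : presheaf_hom (plus P) (plus Q) :=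
  PresheafHom plus_map_res.
End PlusMap.

(* Applying the plus construction twice gives the associated sheaf.  For a
   presheaf of abelian groups the plus construction is computed on underlying
   sets, with pointwise operations on matching families, so the sheafification
   of S |-> M (x)_R S is taken here as a sheaf of sets. *)
Definition sheafify (P : presheaf C) : presheaf C := plus (plus P).

Definition sheafify_unit (P : presheaf C) (U : C) (s : P U) : sheafify P U :=
  plus_unit (plus P) _ (plus_unit P _ s).

Definition sheafify_map (P Q : presheaf C) (a : presheaf_hom P Q) :
  presheaf_hom (sheafify P) (sheafify Q) := plus_map (plus_map a).

(* Sections over [U] of the image sheaf of [a], as a subsheaf of [Q]: those
   which locally come from [P]. *)
Definition image_sheaf (P Q : presheaf C) (a : presheaf_hom P Q) (U : C)
    (s : Q U) : Prop :=
  exists D : sieve U, covering cov D /\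
    forall V (f : hom V U), D _ f -> exists t : P V, a _ t = res f s.

End Plus.

Record is_prime_ideal (S : comPzRingType) (p : S -> Prop) : Prop := IsPrimeIdeal {
  prime_ideal0 : p 0;
  prime_idealD : forall x y, p x -> p y -> p (x + y);
  prime_idealMl : forall a x, p x -> p (a * x);
  prime_ideal1 : ~ p 1;
  prime_idealM : forall x y, p (x * y) -> p x \/ p y }.

Definition Spec_surjective (S T : comPzRingType) (f : {rmorphism S -> T}) : Prop :=
  forall p : S -> Prop, is_prime_ideal p ->
    exists q : T -> Prop, is_prime_ideal q /\ forall x, q (f x) <-> p x.

(* T is the only subring of T containing f(S) and the finite sequence [t]. *)
Definition finite_type (S T : comPzRingType) (f : {rmorphism S -> T}) : Prop :=
  exists t : seq T, forall A : {pred T}, subring_closed A ->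
    (forall x, f x \in A) -> {subset t <= A} -> forall y, y \in A.

Record algebra (R : comPzRingType) := Algebra {
  alg_ring :> comPzRingType;
  alg_str : {rmorphism R -> alg_ring} }.

Record alg_hom (R : comPzRingType) (S T : algebra R) := AlgHom {
  alg_fun :> {rmorphism S -> T};
  alg_funE : forall r, alg_fun (alg_str S r) = alg_str T r }.

Fact alg_hom_ext (R : comPzRingType) (S T : algebra R) (f g : alg_hom S T) :
  f =1 g -> f = g.
Proof.
case: f g => [[f [[f0] [f1]]] fE] [[g [[g0] [g1]]] gE] /= fg.
have {}fg : f = g by apply: functional_extensionality_dep.
subst g; rewrite (Prop_irrelevance g0 f0) (Prop_irrelevance g1 f1) in gE *.
by congr AlgHom; apply: Prop_irrelevance.
Qed.

Definition alg_id (R : comPzRingType) (S : algebra R) : alg_hom S S :=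
  @AlgHom R S S idfun (fun=> erefl).

Fact alg_compE (R : comPzRingType) (S T T' : algebra R)
    (f : alg_hom S T) (g : alg_hom T T') r :
  (g \o f) (alg_str S r) = alg_str T' r.
Proof. by rewrite /= !alg_funE. Qed.

Definition alg_comp (R : comPzRingType) (S T T' : algebra R)
    (f : alg_hom S T) (g : alg_hom T T') : alg_hom S T' :=
  @AlgHom R S T' (g \o f) (alg_compE f g).

Section SurjectiveSite.
Variables (R : comPzRingType) (ft : bool).

(* The affine X-schemes for X = Spec R; if [ft] is set, only those of finite
   type over X. *)
Record affine_scheme := AffineScheme {
  scheme_alg :> algebra R;
  scheme_ft : ft -> finite_type (alg_str scheme_alg) }.

(* The morphisms V -> U over X are the R-algebra morphisms O(U) -> O(V). *)
Definition scheme_hom (V U : affine_scheme) : Type := alg_hom U V.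

Definition affine_schemes : category.
Proof.
refine (@Category affine_scheme scheme_hom (fun U => alg_id U)
  (fun U V W f g => alg_comp f g) _ _ _) => *; exact: alg_hom_ext.
Defined.

Definition surjective_cov (U V : affine_schemes) (f : hom V U) : Prop :=
  Spec_surjective (f : alg_hom U V) /\ finite_type (f : alg_hom U V).

Fact base_scheme_ft : ft -> finite_type (idfun : {rmorphism R -> R}).
Proof. by move=> _; exists [::] => A _ h _; apply: h. Qed.

Definition base_scheme : affine_schemes :=
  @AffineScheme (@Algebra R R idfun) base_scheme_ft.

Section ModulePresheaf.
Variable M : lmodType R.

Definition module_sec (U : affine_schemes) : Type := tensor M (alg_str U).

Definition module_res (U V : affine_schemes) (f : hom V U) :
    module_sec U -> module_sec V :=
  @tensor_base_change R M U V (alg_str U) (alg_str V) (f : alg_hom U V).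

Fact module_res_pure (U V : affine_schemes) (f : hom V U) m s :
  module_res f (tpure _ m s) = tpure _ m ((f : alg_hom U V) s).
Proof.
exact/(@tlift_pure R M U (alg_str U))/tensor_base_change_balanced/alg_funE.
Qed.

Fact module_resB (U V : affine_schemes) (f : hom V U) :
  {morph (module_res f : tensor M (alg_str U) -> tensor M (alg_str V)) :
    x y / x - y}.
Proof. exact/tlift_additive/tensor_base_change_balanced/alg_funE. Qed.

Fact module_res1 U (s : module_sec U) : module_res (idm U) s = s.
Proof.
move: s; apply: (@tensor_ext R M U (alg_str U) (tensor M (alg_str U))
  (module_res (idm U)) id (module_resB _)) => // m s.
exact: module_res_pure.
Qed.

Fact module_resM (U V W : affine_schemes) (f : hom V U) (g : hom W V) s :
  module_res (comp f g) s = module_res g (module_res f s).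
Proof.
move: s; apply: (@tensor_ext R M U (alg_str U) (tensor M (alg_str W))
  (module_res (comp f g)) (module_res g \o module_res f) (module_resB _)).
  by move=> x y /=; rewrite !module_resB.
by move=> m s; rewrite /= !module_res_pure.
Qed.

Definition module_presheaf : presheaf affine_schemes :=
  Presheaf module_res1 module_resM.
End ModulePresheaf.

Section ModulePresheafHom.
Variables (M M' : lmodType R) (f : {linear M -> M'}).

Fact module_map_res (U V : affine_schemes) (h : hom V U) (s : module_sec M U) :
  tensor_map f (module_res h s) = module_res h (tensor_map f s) :> module_sec M' V.
Proof.
have fB W : {morph (@tensor_map R M M' _ (alg_str (W : affine_scheme)) f) : x y / x - y}.
  exact/tlift_additive/tensor_map_balanced.
have fp W m t : tensor_map f (tpure (alg_str (W : affine_scheme)) m t) = tpure _ (f m) t.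
  exact/tlift_pure/tensor_map_balanced.
move: s; apply: (@tensor_ext R M U (alg_str U) (tensor M' (alg_str V))
  (tensor_map f \o module_res h) (module_res h \o tensor_map f)).
- by move=> x y /=; rewrite module_resB fB.
- by move=> x y /=; rewrite fB module_resB.
- by move=> m s; rewrite /= module_res_pure !fp module_res_pure.
Qed.

Definition module_presheaf_hom :
    presheaf_hom (module_presheaf M) (module_presheaf M') :=
  @PresheafHom _ (module_presheaf M) (module_presheaf M')
    (fun U => @tensor_map R M M' U (alg_str U) f) module_map_res.
End ModulePresheafHom.

Definition Mtop (M : lmodType R) : presheaf affine_schemes :=
  sheafify surjective_cov (module_presheaf M).

Definition Mtop_map (M M' : lmodType R) (f : {linear M -> M'}) :
    presheaf_hom (Mtop M) (Mtop M') :=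
  sheafify_map surjective_cov (module_presheaf_hom f).

Definition theta (M : lmodType R) (m : M) : Mtop M base_scheme :=
  sheafify_unit surjective_cov (P := module_presheaf M) (U := base_scheme)
    (tpure _ m 1).

Definition surjective_closure (M : lmodType R) (N : submodClosed M) (m : M) : Prop :=
  image_sheaf surjective_cov (Mtop_map (submod_incl N)) (theta m).

End SurjectiveSite.

Record is_ideal (R : comPzRingType) (I : R -> Prop) : Prop := IsIdeal {
  ideal0 : I 0;
  idealD : forall x y, I x -> I y -> I (x + y);
  idealMl : forall a x, I x -> I (a * x) }.

Definition noetherian (R : comPzRingType) : Prop :=
  forall I : R -> Prop, is_ideal I ->
    exists (n : nat) (g : 'I_n -> R),
      forall x, I x <-> exists c : 'I_n -> R, x = \sum_i c i * g i.

(* Bounded length of the chains p 0 < p 1 < ... < p n of prime ideals; the zero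
   ring is finite dimensional. *)
Definition finite_dimensional (R : comPzRingType) : Prop :=
  exists d : nat, forall (n : nat) (p : nat -> R -> Prop),
    (forall i, (i <= n)%N -> is_prime_ideal (p i)) ->
    (forall i, (i < n)%N ->
       (forall x, p i x -> p i.+1 x) /\ exists x, p i.+1 x /\ ~ p i x) ->
    (n <= d)%N.

(* Main.v *)
(* An element m lies in the radical of N iff every R-linear map M -> K over a field K
   which kills N kills m, because vector spaces have enough linear forms.

   Closure => radical: a point Spec K -> U lifts, after a field extension, along every
   covering sieve of U.  Hence if m is locally in the image of N, then m (x) 1 lies in the
   image of N (x) W for some W with a point over an extension of K, and a linear map as
   above may be evaluated there.

   Radical => closure: by compactness (an ultraproduct argument) finitely many linear
   relations in M/N suffice to force m = 0 in (M/N) (x) K for all fields K.  Solving the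
   resulting linear system over all residue fields of R at once, and adjoining the solution
   to R inside the product of these fields, gives a surjective R-algebra of finite type
   over which m (x) 1 comes from N. *)
Require Import Defs.
From HB Require Import structures.
From mathcomp Require Import all_boot all_algebra.
From mathcomp Require Import boolp classical_sets.

Set Implicit Arguments.
Unset Strict Implicit.
Unset Printing Implicit Defensive.

(* [Defs] again, as MathComp's [hom] and [comp] would hide those of categories. *)
Import GRing.Theory Defs.
Local Open Scope ring_scope.
Local Open Scope quotient_scope.

(** * Maximal submodules and residue fields *)

Record is_submodule (R : comPzRingType) (M : lmodType R) (P : M -> Prop) : Prop :=
  IsSubmodule {
    submodule0 : P 0;
    submoduleD : forall x y, P x -> P y -> P (x + y);
    submoduleZ : forall a x, P x -> P (a *: x) }.

Lemma submoduleN (R : comPzRingType) (M : lmodType R) (P : M -> Prop) x :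
  is_submodule P -> P x -> P (- x).
Proof. by move=> PP Px; rewrite -scaleN1r; apply: submoduleZ. Qed.

Lemma submoduleB (R : comPzRingType) (M : lmodType R) (P : M -> Prop) x y :
  is_submodule P -> P x -> P y -> P (x - y).
Proof. by move=> PP Px Py; apply: submoduleD => //; apply: submoduleN. Qed.

(** Zorn's lemma on the submodules that contain [N] and miss [v]. The last clause is maximality:
    adding any [x] outside [P] brings [v] in. Over a field this yields a hyperplane, in a ring with
    [v = 1] a prime ideal. *)
Lemma maximal_submodule (R : comPzRingType) (M : lmodType R) (N : M -> Prop) (v : M) :
  is_submodule N -> ~ N v ->
  exists P : M -> Prop, [/\ is_submodule P, forall x, N x -> P x, ~ P v &
    forall x, ~ P x -> exists a p, P p /\ v = p + a *: x].
Proof.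
move=> NP Nv.
pose good P := [/\ is_submodule P, forall x, N x -> P x & ~ P v].
(* The empty set is admitted because [Zorn_bigcup] also takes the union of the empty chain. *)
have [F FG Ftot|P [PP Pmax]] := @Zorn_bigcup M [set P | P = set0 \/ good P].
  have [[A [FA A0]]|Fempty] := pselect (exists A, F A /\ A <> set0); last first.
    left; apply/seteqP; split=> // x [A FA Ax]; apply: Fempty.
    by exists A; split=> // A0; rewrite A0 in Ax.
  right; have Agood : good A by case: (FG _ FA).
  have [AP NA Av] := Agood; split=> [||[B FB Bv]].
  - split=> [|x y [B FB Bx] [C FC Cy]|a x [B FB Bx]].
    + by exists A => //; exact: submodule0.
    + have goodE D z : F D -> D z -> good D.
        by move=> /FG[D0|//]; rewrite D0.
      have [BC|CB] := Ftot _ _ FB FC.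
        exists C => //; have [CP _ _] := goodE _ _ FC Cy.
        by apply: (submoduleD CP) => //; apply: BC.
      exists B => //; have [BP _ _] := goodE _ _ FB Bx.
      by apply: (submoduleD BP) => //; apply: CB.
    + exists B => //; have [B0|[BP _ _]] := FG _ FB; first by rewrite B0 in Bx.
      exact: submoduleZ.
  - by move=> x /NA Ax; exists A.
  - have [B0|[_ _ //]] := FG _ FB; by rewrite B0 in Bv.
have {PP} [PP NP' Pv] : good P.
  case: PP => // P0; case: (Pmax N); last by right; split.
  by rewrite P0; split=> // h; apply: (h 0); exact: submodule0.
(* Otherwise [P + R x] would be a larger submodule that still misses [v]. *)
exists P; split=> // x Px; apply: contrapT => h.
apply: (Pmax (fun y => exists a p, P p /\ y = p + a *: x)).
  split=> [y Py|s]; first by exists 0, y; rewrite scale0r addr0.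
  by apply: Px; apply: s; exists 1, 0; rewrite scale1r add0r; split=> //; exact: submodule0.
right; split=> [|y Ny|//]; last first.
  by exists 0, y; rewrite scale0r addr0; split=> //; exact: NP'.
split=> [|_ _ [a [p [Pp ->]]] [b [q [Pq ->]]]|b _ [a [p [Pp ->]]]].
- by exists 0, 0; rewrite scale0r addr0; split=> //; exact: submodule0.
- exists (a + b), (p + q); rewrite scalerDl addrACA; split=> //; exact: submoduleD.
- exists (b * a), (b *: p); rewrite scalerDr scalerA; split=> //; exact: submoduleZ.
Qed.

(** [P] is a complement of the line [K v]; [g x] is the one scalar [a] with [x - a *: v] in [P]. *)
Lemma vector_functional (K : fieldType) (V : lmodType K) (N : V -> Prop) (v : V) :
  is_submodule N -> ~ N v ->
  exists g : V -> K, [/\ forall x y, g (x + y) = g x + g y,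
    forall a x, g (a *: x) = a * g x, forall x, N x -> g x = 0 & g v = 1].
Proof.
move=> NP Nv; have [P [PP NP' Pv Pmax]] := maximal_submodule NP Nv.
have uniq a b x : P (x - a *: v) -> P (x - b *: v) -> a = b.
  move=> Pa Pb; apply: contrapT => /eqP nab; apply: Pv.
  have Pab : P ((a - b) *: v).
    have -> : (a - b) *: v = (x - b *: v) - (x - a *: v).
      by rewrite opprB [RHS]addrC addrA subrK scalerBl.
    exact: submoduleB.
  rewrite -[v]scale1r -(mulVf (x := a - b)) ?subr_eq0 // -scalerA.
  exact: submoduleZ.
(* For [x] outside [P], maximality gives [v = p + a *: x], and [a] is invertible because [v] is not
   in [P]. *)
have ex x : exists a, P (x - a *: v).
  have [Px|/Pmax [a [p [Pp vE]]]] := pselect (P x).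
    by exists 0; rewrite scale0r subr0.
  have a0 : a != 0.
    by apply/eqP => a0; apply: Pv; rewrite vE a0 scale0r addr0.
  exists a^-1; rewrite vE scalerDr scalerA mulVf // scale1r opprD addrCA subrr addr0.
  by rewrite -scalerN; apply: (submoduleZ PP); apply: submoduleN.
pose g x := projT1 (cid (ex x)); have gP x : P (x - g x *: v) := projT2 (cid (ex x)).
exists g; split=> [x y|a x|x /NP' Px|].
- apply: (uniq _ _ (x + y)) => //.
  by rewrite scalerDl opprD addrACA; apply: submoduleD.
- apply: (uniq _ _ (a *: x)) => //.
  by rewrite -scalerA -scalerBr; apply: submoduleZ.
- by apply: (uniq _ _ x) => //; rewrite scale0r subr0.
- by apply: (uniq _ _ v) => //; rewrite scale1r subrr; exact: submodule0.
Qed.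

Lemma exists_prime_ideal (B : comPzRingType) (I : B -> Prop) :
  is_ideal I -> ~ I 1 ->
  exists p : B -> Prop, is_prime_ideal p /\ forall x, I x -> p x.
Proof.
move=> II I1.
have IS : is_submodule (I : B^o -> Prop).
  split=> [|x y|a x].
  - exact: (ideal0 II).
  - exact: (idealD II).
  - exact: (idealMl II).
have [P [PP IP P1 Pmax]] := maximal_submodule IS I1.
have PM a x : P x -> P (a * x) by apply: (submoduleZ PP).
exists P; split=> //; split=> //; [exact: (submodule0 PP) | exact: (submoduleD PP) |].
(* If [x] is outside, then [1 = p + a * x]; multiplying by [y] puts [y] into the ideal. *)
move=> x y Pxy; have [Px|/Pmax [a [p [Pp E]]]] := pselect (P x); [by left | right].
rewrite -[y]mul1r [1]E mulrDl; apply: (submoduleD PP); first by rewrite mulrC; apply: PM.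
by rewrite -[_ *: _]/(a * x) -mulrA; apply: PM.
Qed.

Section ResidueField.
Variables (B : comNzRingType) (p : B -> Prop) (pP : is_prime_ideal p).

Definition prime_pred : {pred B} := fun x => `[< p x >].

Fact prime_pred_idealr : idealr_closed prime_pred.
Proof.
split=> [||a x y /asboolP px /asboolP py]; first exact/asboolP/(prime_ideal0 pP).
  by apply/asboolPn/(prime_ideal1 pP).
by apply/asboolP/(prime_idealD pP) => //; apply: prime_idealMl.
Qed.
HB.instance Definition _ := isIdealr.Build B prime_pred prime_pred_idealr.

Fact prime_pred_prime : prime_idealr_closed prime_pred.
Proof.
move=> x y /asboolP /(prime_idealM pP) [h|h]; apply/orP; [left|right]; exact/asboolP.
Qed.
HB.instance Definition _ := isPrimeIdealrClosed.Build B prime_pred prime_pred_prime.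

Local Notation D := {ideal_quot prime_pred}.

(** The fraction field is built over a domain with explicit units, so inverses in [B / p] are picked
    classically. *)
Let qunit : pred D := fun x => `[< exists y, y * x = 1 >].
Let qinv (x : D) : D := if pselect (exists y, y * x = 1) is left h then projT1 (cid h) else x.

Fact qmulVx : {in qunit, left_inverse 1 qinv *%R}.
Proof. by move=> x /asboolP h; rewrite /qinv; case: pselect => // h'; case: cid. Qed.
Fact qunitPl x y : y * x = 1 -> qunit x.
Proof. by move=> h; apply/asboolP; exists y. Qed.
Fact qinv_out : {in [predC qunit], qinv =1 id}.
Proof.
by move=> x /asboolPn h; rewrite /qinv; case: pselect.
Qed.
HB.instance Definition _ := GRing.ComNzRing_hasMulInverse.Build D qmulVx qunitPl qinv_out.

HB.instance Definition _ := GRing.ComUnitRing_isIntegral.Build D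
  (@Quotient.rquot_IdomainAxiom B prime_pred).

Lemma residue_field_nz : exists (K : fieldType) (phi : {rmorphism B -> K}),
  forall x, phi x = 0 <-> p x.
Proof.
exists {fraction D}, (@tofrac D \o \pi_D) => x /=; split=> [/eqP|px].
  rewrite tofrac_eq0 -(raddf0 \pi_D) => /eqP/eqP; rewrite -Quotient.idealrBE subr0.
  exact: asboolP.
apply/eqP; rewrite tofrac_eq0 -(raddf0 \pi_D); apply/eqP/eqP.
by rewrite -Quotient.idealrBE subr0; apply/asboolP.
Qed.
End ResidueField.

Lemma residue_field (B : comPzRingType) (p : B -> Prop) : is_prime_ideal p ->
  exists (K : fieldType) (phi : {rmorphism B -> K}), forall x, phi x = 0 <-> p x.
Proof.
(* Destructing [B] makes the rings repacked from its mixins convertible to it. *)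
case: B p => B []; move=> c1 c2 c3 c4 c5 c6 c7 c8 c9 c10 c11.
set B0 := GRing.ComPzRing.Pack _ => p pP; have n10 : (1 : B0) != 0.
  by apply/eqP => h; apply: (prime_ideal1 pP); rewrite h; exact: prime_ideal0.
pose nzB := GRing.PzSemiRing_isNonZero.Build B0 n10.
pose B' : comNzRingType := HB.pack B B0 nzB.
have [K [phi phiP]] := @residue_field_nz B' p pP.
by exists K, phi.
Qed.

Lemma field_kernel_prime (B : comPzRingType) (K : fieldType) (phi : {rmorphism B -> K}) :
  is_prime_ideal (fun x => phi x = 0).
Proof.
split=> [|x y hx hy|a x hx||x y].
- exact: rmorph0. - by rewrite rmorphD hx hy addr0. - by rewrite rmorphM hx mulr0.
- by rewrite rmorph1; apply/eqP/oner_neq0.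
- by rewrite rmorphM => /eqP; rewrite mulf_eq0 => /orP[] /eqP; [left|right].
Qed.

(** * Tensor products and linear forms *)

Lemma morphB_0 (U V : zmodType) (f : U -> V) : {morph f : x y / x - y} -> f 0 = 0.
Proof. by move=> fB; rewrite -[X in f X](subrr 0) fB subrr. Qed.

Lemma morphB_D (U V : zmodType) (f : U -> V) :
  {morph f : x y / x - y} -> {morph f : x y / x + y}.
Proof.
move=> fB x y; have fN : f (- y) = - f y by rewrite -[- y]sub0r fB morphB_0 // sub0r.
by rewrite -[in LHS](opprK y) fB fN opprK.
Qed.

Section TensorModule.
Variables (R : comPzRingType) (M : lmodType R).
Variables (S : comPzRingType) (phi : {rmorphism R -> S}).

Fact tensor_scale_balanced c : balanced phi (fun (m : M) s => tpure phi m (c * s)).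
Proof.
have tP := tpure_balanced M phi.
split=> [m m' s|m s s'|a m s]; first exact: (balancedDl tP).
  by rewrite mulrDr; exact: (balancedDr tP).
by rewrite mulrCA; exact: (balancedZ tP).
Qed.

(** [tensor] is only an abelian group so far; the action on the second factor makes it an
    [S]-module, hence a vector space when [S] is a field. *)
Definition tensor_scale c : tensor M phi -> tensor M phi :=
  tlift (fun m s => tpure phi m (c * s)).

Fact tensor_scaleB c : {morph tensor_scale c : x y / x - y}.
Proof. exact/tlift_additive/tensor_scale_balanced. Qed.

Fact tensor_scale_pure c (m : M) s : tensor_scale c (tpure phi m s) = tpure phi m (c * s).
Proof. exact: (tlift_pure (tensor_scale_balanced c)). Qed.

Fact tensor_scaleA a b x : tensor_scale a (tensor_scale b x) = tensor_scale (a * b) x.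
Proof.
apply: (tensor_ext (f := tensor_scale a \o tensor_scale b)).
- by move=> y z /=; rewrite !tensor_scaleB.
- exact: tensor_scaleB.
- by move=> m s /=; rewrite !tensor_scale_pure mulrA.
Qed.

Fact tensor_scale1 : left_id 1 tensor_scale.
Proof.
apply: (tensor_ext (g := id)) => //; first exact: tensor_scaleB.
by move=> m s; rewrite tensor_scale_pure mul1r.
Qed.

Fact tensor_scaleDr : right_distributive tensor_scale +%R.
Proof.
by move=> a; apply/morphB_D/tensor_scaleB.
Qed.

Fact tensor_scaleDl x : {morph tensor_scale^~ x : a b / a + b}.
Proof.
move=> a b; move: x; apply: (tensor_ext (g := fun x => tensor_scale a x + tensor_scale b x)).
- exact: tensor_scaleB.
- by move=> y z /=; rewrite !tensor_scaleB opprD addrACA.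
- by move=> m s; rewrite !tensor_scale_pure mulrDl; exact: (balancedDr (tpure_balanced M phi)).
Qed.

HB.instance Definition _ := GRing.Zmodule_isLmodule.Build S (tensor M phi)
  tensor_scaleA tensor_scale1 tensor_scaleDr tensor_scaleDl.

Lemma tensorZ_pure c (m : M) s : c *: tpure phi m s = tpure phi m (c * s).
Proof. exact: tensor_scale_pure. Qed.

Lemma tpureDl (m m' : M) s : tpure phi (m + m') s = tpure phi m s + tpure phi m' s.
Proof. exact: (balancedDl (tpure_balanced M phi)). Qed.

Lemma tpureDr (m : M) s s' : tpure phi m (s + s') = tpure phi m s + tpure phi m s'.
Proof. exact: (balancedDr (tpure_balanced M phi)). Qed.

Lemma tpureZ a (m : M) s : tpure phi (a *: m) s = tpure phi m (phi a * s).
Proof. exact: (balancedZ (tpure_balanced M phi)). Qed.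

Lemma tpure0l s : tpure phi (0 : M) s = 0.
Proof. by apply: (addrI (tpure phi (0 : M) s)); rewrite -(tpureDl (0 : M)) !addr0. Qed.

Lemma tpure0r (m : M) : tpure phi m 0 = 0.
Proof. by apply: (addrI (tpure phi m 0)); rewrite -tpureDr !addr0. Qed.

Lemma tpure_suml (I : Type) (r : seq I) (F : I -> M) s :
  tpure phi (\sum_(i <- r) F i) s = \sum_(i <- r) tpure phi (F i) s.
Proof.
elim/big_rec2: _ => [|i x y _ <-]; [exact: tpure0l | exact: tpureDl].
Qed.

Lemma tpure_sumr (I : Type) (r : seq I) (F : I -> S) (m : M) :
  tpure phi m (\sum_(i <- r) F i) = \sum_(i <- r) tpure phi m (F i).
Proof.
elim/big_rec2: _ => [|i x y _ <-]; [exact: tpure0r | exact: tpureDr].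
Qed.

End TensorModule.

Section TensorMap.
Variables (R : comPzRingType) (M M' : lmodType R) (f : {linear M -> M'}).
Variables (S : comPzRingType) (phi : {rmorphism R -> S}).

Lemma tensor_map_pure m s : tensor_map f (tpure phi m s) = tpure phi (f m) s.
Proof. exact: (tlift_pure (tensor_map_balanced phi f)). Qed.

Lemma tensor_mapB : {morph @tensor_map R M M' S phi f : x y / x - y}.
Proof. exact/tlift_additive/tensor_map_balanced. Qed.

Lemma tensor_map0 : tensor_map f (0 : tensor M phi) = 0.
Proof. exact/morphB_0/tensor_mapB. Qed.

Lemma tensor_mapD : {morph @tensor_map R M M' S phi f : x y / x + y}.
Proof. exact/morphB_D/tensor_mapB. Qed.

Lemma tensor_mapZ c (z : tensor M phi) : tensor_map f (c *: z) = c *: tensor_map f z.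
Proof.
move: z; apply: (tensor_ext (f := tensor_map f \o *:%R c) (g := *:%R c \o tensor_map f)).
- by move=> x y /=; rewrite scalerBr tensor_mapB.
- by move=> x y /=; rewrite tensor_mapB scalerBr.
- by move=> m s /=; rewrite !(tensorZ_pure, tensor_map_pure).
Qed.
End TensorMap.

(** These are the [K]-linear forms on [(M / N) (x)_R K], given by their values on the elements
    [x (x) 1]. *)
Record annihilating_functional (R : comPzRingType) (M : lmodType R) (N : submodClosed M)
    (K : comPzRingType) (phi : {rmorphism R -> K}) (g : M -> K) : Prop :=
  AnnihilatingFunctional {
    functionalD : forall x y, g (x + y) = g x + g y;
    functionalZ : forall a x, g (a *: x) = phi a * g x;
    functional0 : forall x, x \in N -> g x = 0 }.

(** The point [y] turns [g] into the additive map [x (x) s |-> g x * y s] on [M (x) S]; it kills the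
    image of [N (x) S] and takes [m (x) 1] to [g m]. *)
Lemma functional_tensor_map (R : comPzRingType) (M : lmodType R) (N : submodClosed M)
    (K : comPzRingType) (phi : {rmorphism R -> K}) (g : M -> K)
    (S : comPzRingType) (psi : {rmorphism R -> S}) (y : {rmorphism S -> K})
    (z : tensor (submod N) psi) m :
  (forall r, y (psi r) = phi r) -> annihilating_functional N phi g ->
  tensor_map (submod_incl N) z = tpure psi m 1 -> g m = 0.
Proof.
move=> yE gP zE.
have bal : balanced psi (fun x s => g x * y s).
  split=> [x x' s|x s s'|a x s].
  - by rewrite (functionalD gP) mulrDl.
  - by rewrite rmorphD mulrDr.
  - by rewrite (functionalZ gP) rmorphM yE mulrCA mulrA.
have := congr1 (tlift (fun x s => g x * y s)) zE.
rewrite (tlift_pure bal) rmorph1 mulr1 => <-.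
have liftB := tlift_additive bal.
apply: (tensor_ext (f := tlift (fun x s => g x * y s) \o tensor_map (submod_incl N))
  (g := fun=> 0)).
- by move=> x x' /=; rewrite tensor_mapB liftB.
- by move=> x x'; rewrite subrr.
- by move=> x s /=; rewrite tensor_map_pure (tlift_pure bal) (functional0 gP (valP x)) mul0r.
Qed.

Lemma radicalP (R : comPzRingType) (M : lmodType R) (N : submodClosed M) (m : M) :
  radical N m <-> forall (K : fieldType) (phi : {rmorphism R -> K}) (g : M -> K),
    annihilating_functional N phi g -> g m = 0.
Proof.
split=> [mN K phi g gP|mP K phi].
  by have [z] := mN K phi; apply: (functional_tensor_map (y := idfun)).
apply: contrapT => notin.
have imP : is_submodule (fun w : tensor M phi =>
    exists z : tensor (submod N) phi, tensor_map (submod_incl N) z = w).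
  split=> [|_ _ [x <-] [y <-]|a _ [x <-]].
  - by exists 0; rewrite tensor_map0.
  - by exists (x + y); rewrite tensor_mapD.
  - by exists (a *: x); rewrite tensor_mapZ.
(* A linear form separates [m (x) 1] from the image of [N (x) K]; its values on the elements
   [x (x) 1] contradict the assumption. *)
have [g [gD gZ g0 g1]] := vector_functional imP notin.
suff : g (tpure phi m 1) = 0 by rewrite g1 => /eqP; rewrite oner_eq0.
apply: (mP K phi (fun x => g (tpure phi x 1))); split=> [x y|a x|x xN].
- by rewrite tpureDl gD.
- by rewrite -gZ tensorZ_pure tpureZ.
- by apply: g0; exists (tpure phi (Submod xN) 1); rewrite tensor_map_pure.
Qed.

(** * Composites of residue fields *)

(** A name for [V] that records [f], so that the [U]-module structure through [f] can be attached to
    it. *)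
Definition scalars_restriction (U V : comPzRingType) (f : {rmorphism U -> V}) : Type := V.

Section ScalarsRestriction.
Variables (U V : comPzRingType) (f : {rmorphism U -> V}).
Local Notation W := (scalars_restriction f).

HB.instance Definition _ := GRing.ComPzRing.on (scalars_restriction f).

Definition restr_scale (a : U) (v : W) : W := f a * v.

Fact restr_scaleA a b v : restr_scale a (restr_scale b v) = restr_scale (a * b) v.
Proof. by rewrite /restr_scale rmorphM mulrA. Qed.
Fact restr_scale1 : left_id 1 restr_scale.
Proof. by move=> v; rewrite /restr_scale rmorph1 mul1r. Qed.
Fact restr_scaleDr : right_distributive restr_scale +%R.
Proof. by move=> a u v; rewrite /restr_scale mulrDr. Qed.
Fact restr_scaleDl v : {morph restr_scale^~ v : a b / a + b}.
Proof. by move=> a b; rewrite /restr_scale rmorphD mulrDl. Qed.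
HB.instance Definition _ := GRing.Zmodule_isLmodule.Build U (scalars_restriction f)
  restr_scaleA restr_scale1 restr_scaleDr restr_scaleDl.
End ScalarsRestriction.

Section TensorRing.
Variables (U V S : comPzRingType) (f : {rmorphism U -> V}) (x : {rmorphism U -> S}).
Local Notation W := (scalars_restriction f).

(** The pushout of [f] and [x]. Its factorwise product is defined by lifting one factor at a
    time. *)
Definition tensor_ring : Type := tensor W x.
HB.instance Definition _ := GRing.Zmodule.on tensor_ring.

Local Notation pure v s := (tpure x (v : W) s : tensor_ring).

Definition tensor_mul_pure (v : W) (s : S) : tensor_ring -> tensor_ring :=
  tlift (fun (v' : W) s' => pure (v * v') (s * s')).

Fact tensor_mul_pure_balanced v s : balanced x (fun (v' : W) s' => pure (v * v') (s * s')).
Proof.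
split=> [u u' t|u t t'|a u t].
- by rewrite mulrDr tpureDl.
- by rewrite mulrDr tpureDr.
- rewrite -[a *: u]/(f a * u) mulrCA -[f a * (v * u)]/(a *: (v * u : W)) tpureZ.
  by rewrite mulrCA.
Qed.

Fact tensor_mul_pureB v s : {morph tensor_mul_pure v s : z z' / z - z'}.
Proof. exact/tlift_additive/tensor_mul_pure_balanced. Qed.

Fact tensor_mul_pureE v s v' s' : tensor_mul_pure v s (pure v' s') = pure (v * v') (s * s').
Proof. exact: (tlift_pure (tensor_mul_pure_balanced v s)). Qed.

Fact tensor_mul_balanced (z : tensor_ring) : balanced x (fun (v : W) s => tensor_mul_pure v s z).
Proof.
split=> [u u' t|u t t'|a u t]; move: z.
- apply: (tensor_ext (g := fun z => tensor_mul_pure u t z + tensor_mul_pure u' t z)).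
  + exact: tensor_mul_pureB.
  + by move=> z z'; rewrite !tensor_mul_pureB opprD addrACA.
  + by move=> v s; rewrite !tensor_mul_pureE mulrDl tpureDl.
- apply: (tensor_ext (g := fun z => tensor_mul_pure u t z + tensor_mul_pure u t' z)).
  + exact: tensor_mul_pureB.
  + by move=> z z'; rewrite !tensor_mul_pureB opprD addrACA.
  + by move=> v s; rewrite !tensor_mul_pureE mulrDl tpureDr.
- apply: tensor_ext; [exact: tensor_mul_pureB | exact: tensor_mul_pureB | move=> v s].
  have E : (a *: u : V) * v = a *: (u * v : W) by rewrite -[RHS]/(f a * (u * v)) mulrA.
  by rewrite !tensor_mul_pureE E tpureZ mulrA.
Qed.

Definition tensor_mul (z z' : tensor_ring) : tensor_ring :=
  tlift (fun (v : W) s => tensor_mul_pure v s z') z.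

Fact tensor_mul_pureEl v s z : tensor_mul (pure v s) z = tensor_mul_pure v s z.
Proof. exact: (tlift_pure (tensor_mul_balanced z)). Qed.

Fact tensor_mulE v s v' s' : tensor_mul (pure v s) (pure v' s') = pure (v * v') (s * s').
Proof. by rewrite tensor_mul_pureEl tensor_mul_pureE. Qed.

Fact tensor_mulBl z : {morph tensor_mul^~ z : u v / u - v}.
Proof. exact/tlift_additive/tensor_mul_balanced. Qed.

Fact tensor_mulBr z : {morph tensor_mul z : u v / u - v}.
Proof.
move=> u v; move: z; apply: (tensor_ext (f := tensor_mul^~ (u - v))
  (g := fun z => tensor_mul z u - tensor_mul z v)).
- exact: tensor_mulBl.
- by move=> z z'; rewrite !tensor_mulBl !opprD !opprK addrACA.
- by move=> w s; rewrite !tensor_mul_pureEl tensor_mul_pureB.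
Qed.

Fact tensor_mulC : commutative tensor_mul.
Proof.
move=> z z'; move: z; apply: (tensor_ext (f := tensor_mul^~ z')).
- exact: tensor_mulBl. - exact: tensor_mulBr.
move=> v s; move: z'; apply: (tensor_ext (g := tensor_mul^~ _)).
- exact: tensor_mulBr. - exact: tensor_mulBl.
by move=> v' s'; rewrite !tensor_mulE mulrC [s * _]mulrC.
Qed.

Fact tensor_mulA : associative tensor_mul.
Proof.
move=> z1 z2 z3; move: z1; apply: (tensor_ext (f := tensor_mul^~ _)
  (g := fun z => tensor_mul (tensor_mul z z2) z3)).
- exact: tensor_mulBl. - by move=> u u'; rewrite !tensor_mulBl.
move=> v1 s1; move: z2; apply: (tensor_ext (f := fun z => tensor_mul _ (tensor_mul z z3))
  (g := fun z => tensor_mul (tensor_mul _ z) z3)).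
- by move=> u u'; rewrite tensor_mulBl tensor_mulBr.
- by move=> u u'; rewrite tensor_mulBr tensor_mulBl.
move=> v2 s2; move: z3; apply: (tensor_ext (f := fun z => tensor_mul _ (tensor_mul _ z))).
- by move=> u u'; rewrite !tensor_mulBr.
- exact: tensor_mulBr.
by move=> v3 s3; rewrite !tensor_mulE !mulrA.
Qed.

Fact tensor_mul1 : left_id (pure 1 1) tensor_mul.
Proof.
apply: (tensor_ext (g := id)) => //; first exact: tensor_mulBr.
by move=> v s; rewrite tensor_mulE !mul1r.
Qed.

Fact tensor_mulDl : left_distributive tensor_mul +%R.
Proof. by move=> z z' w; apply: (morphB_D (tensor_mulBl w)). Qed.

HB.instance Definition _ := GRing.Zmodule_isComPzRing.Build tensor_ring
  tensor_mulA tensor_mulC tensor_mul1 tensor_mulDl.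

Definition tensor_inl (v : V) : tensor_ring := pure v 1.
Definition tensor_inr (s : S) : tensor_ring := pure 1 s.

Fact tensor_inl_zmod : zmod_morphism tensor_inl.
Proof.
have D : {morph tensor_inl : v v' / v + v'} by move=> v v'; apply: tpureDl.
by move=> v v'; apply: (addIr (tensor_inl v')); rewrite -D !subrK.
Qed.
Fact tensor_inl_monoid : monoid_morphism tensor_inl.
Proof. by split=> // v v'; rewrite -[RHS]/(tensor_mul _ _) tensor_mulE mul1r. Qed.
HB.instance Definition _ := GRing.isZmodMorphism.Build V tensor_ring tensor_inl tensor_inl_zmod.
HB.instance Definition _ := GRing.isMonoidMorphism.Build V tensor_ring tensor_inl tensor_inl_monoid.

Fact tensor_inr_zmod : zmod_morphism tensor_inr.
Proof.
have D : {morph tensor_inr : v v' / v + v'} by move=> v v'; apply: tpureDr.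
by move=> v v'; apply: (addIr (tensor_inr v')); rewrite -D !subrK.
Qed.
Fact tensor_inr_monoid : monoid_morphism tensor_inr.
Proof. by split=> // v v'; rewrite -[RHS]/(tensor_mul _ _) tensor_mulE mul1r. Qed.
HB.instance Definition _ := GRing.isZmodMorphism.Build S tensor_ring tensor_inr tensor_inr_zmod.
HB.instance Definition _ := GRing.isMonoidMorphism.Build S tensor_ring tensor_inr tensor_inr_monoid.

Lemma tensor_inlr a : tensor_inl (f a) = tensor_inr (x a).
Proof.
have E : f a = a *: (1 : W) by rewrite -[RHS]/(f a * 1) mulr1.
by rewrite /tensor_inl /tensor_inr E tpureZ mulr1.
Qed.

End TensorRing.

Section FractionSubfield.
Variables (U : comPzRingType) (K : fieldType) (x : {rmorphism U -> K}).

(** The residue field of [U] at the kernel of [x], as a subfield of [K]. *)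
Definition frac_pred : {pred K} :=
  fun z => `[< exists a b, x b != 0 /\ z = x a / x b >].

Fact frac_pred_divring : divring_closed frac_pred.
Proof.
split=> [|_ _ /asboolP[a [b [b0 ->]]] /asboolP[c [d [d0 ->]]]
         |_ _ /asboolP[a [b [b0 ->]]] /asboolP[c [d [d0 ->]]]]; apply/asboolP.
- by exists 1, 1; rewrite rmorph1 oner_eq0 divr1.
- exists (a * d - c * b), (b * d); rewrite rmorphB !rmorphM mulf_eq0 negb_or b0.
  by rewrite d0 -[- (x c / x d)]mulNr addf_div // mulNr.
- have [c0|c0] := eqVneq (x c) 0.
    by exists 0, 1; rewrite c0 mul0r invr0 mulr0 rmorph1 rmorph0 oner_eq0 mul0r.
  exists (a * d), (b * c); rewrite !rmorphM mulf_eq0 negb_or b0 c0; split=> //.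
  by rewrite invf_div mulf_div.
Qed.
HB.instance Definition _ := GRing.isDivringClosed.Build K frac_pred frac_pred_divring.

Record frac_field := FracField { frac_val : K; frac_valP : frac_val \in frac_pred }.
HB.instance Definition _ := [isSub for frac_val].
HB.instance Definition _ := [Choice of frac_field by <:].
HB.instance Definition _ := [SubChoice_isSubIntegralDomain of frac_field by <:].
HB.instance Definition _ := [SubIntegralDomain_isSubField of frac_field by <:].

Fact frac_of_subproof a : x a \in frac_pred.
Proof. by apply/asboolP; exists a, 1; rewrite rmorph1 oner_eq0 divr1. Qed.
Definition frac_of a := FracField (frac_of_subproof a).

Lemma frac_fieldP (z : frac_field) : exists a b, x b != 0 /\ val z = x a / x b.
Proof. exact/asboolP/(valP z). Qed.

Variables (E : fieldType) (e : {rmorphism U -> E}).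
Hypothesis kerE : forall a, x a = 0 <-> e a = 0.

(** The map from that residue field to [E]; equality of kernels makes the value independent of the
    fraction chosen. *)
Definition frac_transfer (z : frac_field) : E :=
  let: exist a h := cid (frac_fieldP z) in e a / e (projT1 (cid h)).

Let ker_eq a b : (x a == x b) = (e a == e b).
Proof.
rewrite -(subr_eq0 (x a)) -(subr_eq0 (e a)) -!rmorphB.
by apply/eqP/eqP => /kerE.
Qed.

Lemma frac_transferE z a b : x b != 0 -> val z = x a / x b -> frac_transfer z = e a / e b.
Proof.
rewrite /frac_transfer; case: cid => c h; case: (cid h) => d /= [d0 ->] b0.
have e0 u : x u != 0 -> e u != 0 by rewrite -(rmorph0 x) ker_eq rmorph0.
move=> /eqP; rewrite eqr_div // -!rmorphM ker_eq !rmorphM => E'.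
by apply/eqP; rewrite eqr_div // e0.
Qed.

Lemma frac_transferD : {morph frac_transfer : y z / y + z}.
Proof.
have e0 u : x u != 0 -> e u != 0 by rewrite -(rmorph0 x) ker_eq rmorph0.
move=> y z; have [a [b [b0 yE]]] := frac_fieldP y; have [c [d [d0 zE]]] := frac_fieldP z.
rewrite (frac_transferE b0 yE) (frac_transferE d0 zE) addf_div ?e0 // -!rmorphM -rmorphD.
apply: frac_transferE; first by rewrite rmorphM mulf_neq0.
by rewrite rmorphD !rmorphM /= -addf_div // -yE -zE.
Qed.

Lemma frac_transferM a z : frac_transfer (frac_of a * z) = e a * frac_transfer z.
Proof.
have [c [d [d0 zE]]] := frac_fieldP z.
rewrite (frac_transferE d0 zE) mulrA -rmorphM; apply: frac_transferE => //.
by rewrite rmorphM -mulrA -zE.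
Qed.

Lemma frac_transfer1 : frac_transfer 1 = 1.
Proof.
rewrite (@frac_transferE _ 1 1) ?rmorph1 ?oner_eq0 ?divr1 //.
Qed.

(* A [kappa]-linear form on [K], for the common residue field [kappa] inside [K] and [E]. *)
Lemma field_functional : exists l : K -> E,
  [/\ forall s t, l (s + t) = l s + l t, forall a s, l (x a * s) = e a * l s & l 1 = 1].
Proof.
pose V := scalars_restriction (val : {rmorphism frac_field -> K}).
have N0 : is_submodule (fun v : V => v = 0).
  by split=> [|u v -> ->|a v ->]; rewrite ?addr0 ?scaler0.
have n10 : ~ (1 : V) = 0 by apply/eqP/(oner_neq0 K).
have [l [lD lZ _ l1]] := vector_functional N0 n10.
exists (fun s => frac_transfer (l s)); split=> [s t|a s|].
- by rewrite lD frac_transferD.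
- by rewrite -frac_transferM -lZ.
- by rewrite l1 frac_transfer1.
Qed.
End FractionSubfield.

(* [L] is a residue field of [V (x)_U K], which is nonzero because of a linear form on [K]. *)
Lemma compositum (U V : comPzRingType) (f : {rmorphism U -> V}) (K E : fieldType)
    (x : {rmorphism U -> K}) (e : {rmorphism V -> E}) :
  (forall a, x a = 0 <-> e (f a) = 0) ->
  exists (L : fieldType) (i : {rmorphism K -> L}) (y : {rmorphism V -> L}),
    forall a, y (f a) = i (x a).
Proof.
move=> kerE; have [l [lD lM l1]] := @field_functional U K x E (e \o f) kerE.
have bal : balanced x (fun (v : scalars_restriction f) s => e v * l s).
  split=> [v v' s|v s s'|a v s].
  - by rewrite rmorphD mulrDl.
  - by rewrite lD mulrDr.
  - by rewrite lM -[a *: v]/(f a * v) rmorphM mulrCA mulrA.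
have I0 : is_ideal (fun z : tensor_ring f x => z = 0).
  by split=> [|u v -> ->|a v ->]; rewrite ?addr0 ?mulr0.
have n10 : ~ (1 : tensor_ring f x) = 0.
  move=> /(congr1 (tlift (fun (v : scalars_restriction f) s => e v * l s))).
  rewrite (morphB_0 (tlift_additive bal)) (tlift_pure bal) l1 mulr1 rmorph1.
  by apply/eqP/oner_neq0.
have [p [pP _]] := exists_prime_ideal I0 n10.
have [L [phi _]] := residue_field pP.
exists L, (phi \o @tensor_inr U V K f x), (phi \o @tensor_inl U V K f x) => a /=.
by rewrite tensor_inlr.
Qed.

(** A prime [q] over the kernel of [x] has a residue field extending that of the kernel, just as [K]
    does; the two have a composite. *)
Lemma surjective_point_lift (U V : comPzRingType) (f : {rmorphism U -> V}) (K : fieldType)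
    (x : {rmorphism U -> K}) : Spec_surjective f ->
  exists (L : fieldType) (i : {rmorphism K -> L}) (y : {rmorphism V -> L}),
    forall a, y (f a) = i (x a).
Proof.
move=> /(_ _ (field_kernel_prime x)) [q [qP qE]].
have [E [e eE]] := residue_field qP.
by apply: (compositum (e := e)) => a; rewrite -qE -eE.
Qed.

(** * Lifting points along covering sieves *)

Section GeneratedSubalgebra.
Variables (R B : comPzRingType) (phi : {rmorphism R -> B}) (t : seq B).

Definition gen_pred : {pred B} := fun z => `[< forall A : {pred B}, subring_closed A ->
  (forall r, phi r \in A) -> {subset t <= A} -> z \in A >].

Fact gen_pred_subring : subring_closed gen_pred.
Proof.
split=> [|y z /asboolP yG /asboolP zG|y z /asboolP yG /asboolP zG]; apply/asboolP => A AP;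
  have [A1 AB AM] := AP => phiA tA //.
- by apply: AB; [exact: yG | exact: zG].
- by apply: AM; [exact: yG | exact: zG].
Qed.
HB.instance Definition _ := GRing.isSubringClosed.Build B gen_pred gen_pred_subring.

Record gen_alg := GenAlg { gen_val : B; gen_valP : gen_val \in gen_pred }.
HB.instance Definition _ := [isSub for gen_val].
HB.instance Definition _ := [Choice of gen_alg by <:].
HB.instance Definition _ := GRing.SubChoice_isSubComPzRing.Build B gen_pred gen_alg gen_pred_subring.

Section Corestriction.
Variables (S : comPzRingType) (g : {rmorphism S -> B}) (gG : forall s, g s \in gen_pred).

Definition gen_corestr (s : S) : gen_alg := GenAlg (gG s).

Fact gen_corestr_zmod : zmod_morphism gen_corestr.
Proof. by move=> a b; apply: val_inj; rewrite /= rmorphB. Qed.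
Fact gen_corestr_monoid : monoid_morphism gen_corestr.
Proof. by split=> [|a b]; apply: val_inj; rewrite /= ?rmorph1 ?rmorphM. Qed.
HB.instance Definition _ := GRing.isZmodMorphism.Build S gen_alg gen_corestr gen_corestr_zmod.
HB.instance Definition _ := GRing.isMonoidMorphism.Build S gen_alg gen_corestr gen_corestr_monoid.
End Corestriction.

Lemma gen_pred_base r : phi r \in gen_pred.
Proof. by apply/asboolP => A _ phiA _; apply: phiA. Qed.

Lemma gen_pred_gen u : u \in t -> u \in gen_pred.
Proof. by move=> ut; apply/asboolP => A _ _; apply. Qed.

Definition gen_str : {rmorphism R -> gen_alg} := gen_corestr gen_pred_base.

Lemma gen_str_finite_type : finite_type gen_str.
Proof.
exists (pmap insub t) => A [A1 AB AM] strA tA y.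
(* A subring of [gen_alg] is tested by its image in [B], where the defining property of [gen_pred]
   applies. *)
pose A' : {pred B} := fun z => `[< exists2 y, y \in A & val y = z >].
suff /asboolP[y' y'A /val_inj <-//] : val y \in A'.
have /asboolP yG := valP y; apply: yG => [|r|u ut].
- split=> [|_ _ /asboolP[a aA <-] /asboolP[b bA <-]|_ _ /asboolP[a aA <-] /asboolP[b bA <-]];
    apply/asboolP.
  + by exists 1.
  + by exists (a - b); rewrite ?rmorphB //; apply: AB.
  + by exists (a * b); rewrite ?rmorphM //; apply: AM.
- by apply/asboolP; exists (gen_str r).
- apply/asboolP; exists (GenAlg (gen_pred_gen ut)) => //.
  by apply: tA; rewrite mem_pmap_sub.
Qed.
End GeneratedSubalgebra.

(** The preimage of [A] under [g] is a subring of [S] that contains the generators. *)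
Lemma finite_type_closed (R S B : comPzRingType) (f : {rmorphism R -> S}) (t : seq S)
    (g : {rmorphism S -> B}) (A : {pred B}) :
  (forall A : {pred S}, subring_closed A -> (forall x, f x \in A) ->
    {subset t <= A} -> forall y, y \in A) ->
  subring_closed A -> (forall r, g (f r) \in A) -> {subset map g t <= A} ->
  forall s, g s \in A.
Proof.
move=> tP [A1 AB AM] fA tA; apply: (tP [pred s | g s \in A]) => [|//|s st].
  by split=> [|a b|a b]; rewrite !inE ?rmorph1 ?rmorphB ?rmorphM //; [apply: AB | apply: AM].
by apply: tA; apply: map_f.
Qed.

Section Points.
Variables (R : comPzRingType) (ft : bool).
Local Notation scheme := (affine_scheme R ft).
Local Notation cov := (@surjective_cov R ft).

(* [Z] stands in for the fibre product of [V] and [W] at the given point; it is the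
   subring of [L] that they generate, so that it stays of finite type if [ft] is set. *)
Lemma join_scheme (V W : scheme) (L : comPzRingType)
    (v : {rmorphism V -> L}) (w : {rmorphism W -> L}) :
  (forall r, v (alg_str V r) = w (alg_str W r)) ->
  exists (Z : scheme) (g : alg_hom V Z) (h : alg_hom W Z) (z : {rmorphism Z -> L}),
    [/\ injective z, forall a, z (g a) = v a & forall a, z (h a) = w a].
Proof.
move=> vw; pose phi := v \o alg_str V.
(* Without a finiteness condition [L] itself serves as [Z]. *)
have /orP[ftF|ftT] : ~~ ft || ft by case: (ft).
  have Zft : ft -> finite_type (phi : {rmorphism R -> L}) by move=> ftT; rewrite ftT in ftF.
  exists (@AffineScheme R ft (@Algebra R L phi) Zft).
  exists (@AlgHom R V (@Algebra R L phi) v (fun=> erefl)).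
  have wE r : w (alg_str W r) = phi r by rewrite -vw.
  by exists (@AlgHom R W (@Algebra R L phi) w wE), idfun; split.
have [tV tVP] := scheme_ft V ftT; have [tW tWP] := scheme_ft W ftT.
pose t := map v tV ++ map w tW.
pose phi' : {rmorphism R -> L} := phi.
have subG := gen_pred_subring phi' t.
have vG a : v a \in gen_pred phi' t.
  apply: (finite_type_closed tVP subG) => [r|u uV]; first exact: (gen_pred_base phi').
  by apply: gen_pred_gen; rewrite mem_cat uV.
have wG a : w a \in gen_pred phi' t.
  apply: (finite_type_closed tWP subG) => [r|u uW].
    by rewrite -vw; exact: (gen_pred_base phi').
  by apply: gen_pred_gen; rewrite mem_cat uW orbT.
pose Z0 := @Algebra R (gen_alg phi' t) (gen_str phi' t).
have vE r : gen_corestr vG (alg_str V r) = alg_str Z0 r by exact: val_inj.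
have wE r : gen_corestr wG (alg_str W r) = alg_str Z0 r by apply: val_inj; rewrite /= -vw.
exists (@AffineScheme R ft Z0 (fun _ => gen_str_finite_type phi' t)).
exists (@AlgHom R V Z0 (gen_corestr vG) vE), (@AlgHom R W Z0 (gen_corestr wG) wE).
by exists (val : {rmorphism gen_alg phi' t -> L}); split=> //; exact: val_inj.
Qed.

(** Induction on how the sieve is generated: a generator lifts the point by surjectivity,
    transitivity composes two lifts, and a pullback needs a common refinement of two schemes. *)
Lemma covering_point (U : affine_schemes R ft) (D : sieve U) : covering cov D ->
  forall (K : fieldType) (x : {rmorphism (U : scheme) -> K}),
  exists (L : fieldType) (i : {rmorphism K -> L}) (V : affine_schemes R ft)
    (f : hom V U) (y : {rmorphism (V : scheme) -> L}),
    D _ f /\ forall a, y ((f : alg_hom (U : scheme) (V : scheme)) a) = i (x a).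
Proof.
elim=> {U D} [U V f D [fS _] fD K x|U D D1 K x|U V h D _ IH K x|U D D' _ IH _ IH' K x].
- have [L [i [y yE]]] := surjective_point_lift x fS.
  by exists L, i, V, f, y.
- by exists K, idfun, U, (idm U), x.
(* Pullback along [h]: the image of the point in [U] lifts to some [W] in [D], and [Z] joins [V] and
   [W] inside [L]. The resulting square commutes because [z] is injective. *)
- have [L [i [W [f [y [fD yE]]]]]] := IH K (x \o (h : alg_hom (U : scheme) (V : scheme))).
  have vw r : (i \o x) (alg_str (V : scheme) r) = y (alg_str (W : scheme) r).
    rewrite -(alg_funE (f : alg_hom (U : scheme) (W : scheme))) yE /=.
    by rewrite (alg_funE (h : alg_hom (U : scheme) (V : scheme))).
  have [Z [g [k [z [z_inj gE kE]]]]] := @join_scheme V W L (i \o x) y vw.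
  exists L, i, Z, g, z; split=> [|a]; last exact: gE.
  have E : comp h (g : hom (Z : affine_schemes R ft) V) = comp f (k : hom (Z : affine_schemes R ft) W).
    by apply: alg_hom_ext => a /=; apply: z_inj; rewrite gE kE yE.
  by have := sieve_comp (k : hom (Z : affine_schemes R ft) W) fD; rewrite -E.
- have [L [i [V [f [y [fD yE]]]]]] := IH K x.
  have [L' [i' [W [g [z [gD zE]]]]]] := IH' V f fD L y.
  exists L', (i' \o i), W, (comp f g), z; split=> // a.
  by rewrite /= zE yE.
Qed.
End Points.

(** * Local sections of the image sheaf, and their translation to tensors *)

Section PrincipalSieve.
Variables (C : category) (U V : C) (h : hom V U).

Fact principal_sieve_comp W X (k : hom W U) (g : hom X W) :
  (exists j : hom W V, k = comp h j) -> exists j : hom X V, comp k g = comp h j.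
Proof. by case=> j ->; exists (comp j g); rewrite compA. Qed.

Definition principal_sieve : sieve U :=
  @Sieve C U (fun W k => exists j : hom W V, k = comp h j) principal_sieve_comp.

Lemma principal_sieve_self : principal_sieve _ h.
Proof. by exists (idm V); rewrite compm1. Qed.
End PrincipalSieve.

Section PlusLocal.
Variables (C : category) (cov : forall U V : C, hom V U -> Prop).

Lemma ls_class_local (P : presheaf C) U (x : local_section cov P U) V (f : hom V U)
    (fD : ls_dom x _ f) :
  plus_res f (class_of (@ls_eqv C cov P U) x) = plus_unit cov P V (ls_fam fD).
Proof.
rewrite plus_res_class; apply/ls_class_eq; exists (max_sieve V).
split=> [|W g _]; first exact: max_sieve_covering.
have gD : pull (ls_dom x) f _ g by apply: sieve_comp.
by exists gD, I; rewrite /= /ls_res_fam (ls_matching fD).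
Qed.

Lemma plus_map_unit (P Q : presheaf C) (a : presheaf_hom P Q) U (s : P U) :
  plus_map cov a U (plus_unit cov P U s) = plus_unit cov Q U (a U s).
Proof.
rewrite [LHS]plus_map_class; apply/ls_class_eq; exists (max_sieve U).
split=> [|V f _]; first exact: max_sieve_covering.
by exists I, I; rewrite /= app_res.
Qed.

Lemma sheafify_map_unit (P Q : presheaf C) (a : presheaf_hom P Q) U (s : P U) :
  sheafify_map cov a U (sheafify_unit cov s) = sheafify_unit cov (a U s).
Proof. by rewrite /sheafify_unit [LHS]plus_map_unit [X in plus_unit _ _ _ X]plus_map_unit. Qed.

Lemma sheafify_unit_res (P : presheaf C) U V (f : hom V U) (s : P U) :
  res f (sheafify_unit cov s) = sheafify_unit cov (res f s).
Proof. by rewrite /sheafify_unit !app_res. Qed.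

(* The objects through which a fixed point of the site can be lifted. *)
Variable pointed : C -> Prop.
Hypothesis pointed_cov : forall U (D : sieve U), covering cov D -> pointed U ->
  exists V (f : hom V U), D _ f /\ pointed V.

(** Of a covering sieve on which the section comes from [P], one member through which the point
    lifts is enough. *)
Lemma plus_lift (P : presheaf C) U (s : plus cov P U) : pointed U ->
  exists V (f : hom V U) (t : P V), pointed V /\ res f s = plus_unit cov P V t.
Proof.
move=> pU; rewrite -[s]class_reprK; move: (class_repr s) => x.
have [V [f [fD pV]]] := pointed_cov (ls_cov x) pU.
by exists V, f, (ls_fam fD); split=> //; exact: ls_class_local.
Qed.

Lemma plus_unit_local (P : presheaf C) U (s t : P U) : pointed U ->
  plus_unit cov P U s = plus_unit cov P U t ->
  exists V (f : hom V U), pointed V /\ res f s = res f t.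
Proof.
move=> pU /ls_class_eq [D [cD DP]].
have [V [f [fD pV]]] := pointed_cov cD pU; exists V, f; split=> //.
by have [fx [fy]] := DP _ _ fD.
Qed.

(** One refinement enters the sieve where the image is attained. Then each of the two plus
    constructions takes one refinement to lift the section and one to make the two sides agree, all
    keeping the point. *)
Lemma image_sheaf_local (P Q : presheaf C) (a : presheaf_hom P Q) U (s : Q U) :
  pointed U -> image_sheaf cov (sheafify_map cov a) (sheafify_unit cov s) ->
  exists V (f : hom V U) (t : P V), pointed V /\ a V t = res f s.
Proof.
move=> pU [D [cD DP]]; have [V1 [f1 [fD p1]]] := pointed_cov cD pU.
have [t0 t0E] := DP _ _ fD; rewrite sheafify_unit_res in t0E.
have [V2 [f2 [t2 [p2 t2E]]]] := plus_lift t0 p1.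
have := congr1 (res f2) t0E; rewrite sheafify_unit_res -app_res.
rewrite [X in sheafify_map _ _ _ X]t2E [LHS]plus_map_unit.
move=> /(plus_unit_local p2) [V3 [f3 [p3 E3]]].
have [V4 [f4 [t4 [p4 t4E]]]] := plus_lift (res f3 t2) p3.
have := congr1 (res f4) E3; rewrite -!app_res t4E plus_map_unit.
move=> /(plus_unit_local p4) [V5 [f5 [p5 E5]]].
exists V5, (comp (comp (comp (comp f1 f2) f3) f4) f5), (res f5 t4).
by split=> //; rewrite app_res E5 !resM.
Qed.

End PlusLocal.

Lemma surjective_closure_radical (R : comPzRingType) (ft : bool) (M : lmodType R)
    (N : submodClosed M) (m : M) : surjective_closure ft N m -> radical N m.
Proof.
move=> clN; apply/radicalP => K phi g gP; apply: contrapT => gm.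
(* [U] is pointed when it has a point over an extension of [K] lying above [phi]; on the base, [phi]
   itself is one. *)
pose pointed (U : affine_schemes R ft) := exists (L : fieldType)
  (y : {rmorphism (U : affine_scheme R ft) -> L}) (i : {rmorphism K -> L}),
  forall r, y (alg_str (U : affine_scheme R ft) r) = i (phi r).
have pointed_cov (U : affine_schemes R ft) (D : sieve U) :
    covering (@surjective_cov R ft) D -> pointed U ->
    exists V (f : hom V U), D _ f /\ pointed V.
  move=> cD [L [x [i xE]]]; have [L' [i' [V [f [y [fD yE]]]]]] := covering_point cD x.
  exists V, f; split=> //; exists L', y, (i' \o i) => r /=.
  by rewrite -xE -yE (alg_funE (f : alg_hom (U : affine_scheme R ft) (V : affine_scheme R ft))).
have p0 : pointed (base_scheme R ft) by exists K, phi, idfun.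
have [V [f [t [[L [y [i yE]]] tE]]]] := image_sheaf_local pointed_cov p0 clN.
have igP : annihilating_functional N (i \o phi) (i \o g).
  split=> [u v|a u|u uN] /=.
  - by rewrite (functionalD gP) rmorphD.
  - by rewrite (functionalZ gP) rmorphM.
  - by rewrite (functional0 gP uN) rmorph0.
(* Field homomorphisms are injective, so [g m = 0] may be checked in [L]. *)
apply: gm; apply/eqP; rewrite -(fmorph_eq0 i); apply/eqP.
apply: (functional_tensor_map (y := y) (phi := i \o phi) (z := t) _ igP) => [//|].
rewrite [LHS]tE [LHS]module_res_pure.
by rewrite (rmorph1 (f : alg_hom (base_scheme R ft : affine_scheme R ft) (V : affine_scheme R ft))).
Qed.

(** On every member of the sieve generated by the cover, the restriction of [z] gives a preimage.
    Finite type serves twice: it makes [f] a covering and [V] an object of either site. *)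
Lemma cover_surjective_closure (R : comPzRingType) (ft : bool) (M : lmodType R)
    (N : submodClosed M) (m : M) (V : comPzRingType) (f : {rmorphism R -> V})
    (z : tensor (submod N) f) :
  Spec_surjective f -> finite_type f ->
  tensor_map (submod_incl N) z = tpure f m 1 -> surjective_closure ft N m.
Proof.
move=> fS fF zE; pose V' : affine_schemes R ft := @AffineScheme R ft (@Algebra R V f) (fun=> fF).
pose h : hom V' (base_scheme R ft) :=
  @AlgHom R (base_scheme R ft : affine_scheme R ft) (V' : affine_scheme R ft) f (fun=> erefl).
exists (principal_sieve h); split.
  apply: (@CoveringGen _ (@surjective_cov R ft) _ _ h); first by split.
  exact: principal_sieve_self.
move=> W _ [g ->].
pose z' := res g (z : module_presheaf ft (submod N) V').
exists (sheafify_unit (@surjective_cov R ft) z').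
rewrite [LHS]sheafify_map_unit [RHS]sheafify_unit_res; congr sheafify_unit.
rewrite resM /z' app_res; congr (res g _).
rewrite [LHS]zE [RHS]module_res_pure; congr tpure.
by rewrite /= rmorph1.
Qed.

(** * Compactness and the covering *)

Definition dprod (I : Type) (B : I -> comPzRingType) : Type := forall i, B i.

Section ProductRing.
Variables (I : Type) (B : I -> comPzRingType).
Local Notation T := (dprod B).

HB.instance Definition _ := gen_eqMixin (dprod B).
HB.instance Definition _ := gen_choiceMixin (dprod B).

Let ext (x y : T) : (forall i, x i = y i) -> x = y.
Proof. exact: functional_extensionality_dep. Qed.

Definition dprod_add (x y : T) : T := fun i => x i + y i.
Definition dprod_opp (x : T) : T := fun i => - x i.
Definition dprod_mul (x y : T) : T := fun i => x i * y i.

Fact dprod_addA : associative dprod_add.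
Proof. by move=> x y z; apply: ext => i; apply: addrA. Qed.
Fact dprod_addC : commutative dprod_add.
Proof. by move=> x y; apply: ext => i; apply: addrC. Qed.
Fact dprod_add0 : left_id (fun=> 0) dprod_add.
Proof. by move=> x; apply: ext => i; apply: add0r. Qed.
Fact dprod_addN : left_inverse (fun=> 0) dprod_opp dprod_add.
Proof. by move=> x; apply: ext => i; apply: addNr. Qed.
HB.instance Definition _ := GRing.isZmodule.Build (dprod B)
  dprod_addA dprod_addC dprod_add0 dprod_addN.

Fact dprod_mulA : associative dprod_mul.
Proof. by move=> x y z; apply: ext => i; apply: mulrA. Qed.
Fact dprod_mulC : commutative dprod_mul.
Proof. by move=> x y; apply: ext => i; apply: mulrC. Qed.
Fact dprod_mul1 : left_id (fun=> 1) dprod_mul.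
Proof. by move=> x; apply: ext => i; apply: mul1r. Qed.
Fact dprod_mulDl : left_distributive dprod_mul +%R.
Proof. by move=> x y z; apply: ext => i; apply: mulrDl. Qed.
HB.instance Definition _ := GRing.Zmodule_isComPzRing.Build (dprod B)
  dprod_mulA dprod_mulC dprod_mul1 dprod_mulDl.

Lemma dprod_ext (x y : T) : (forall i, x i = y i) -> x = y.
Proof. exact: ext. Qed.

Definition dprod_proj (i : I) (x : T) : B i := x i.
Fact dprod_proj_zmod i : zmod_morphism (dprod_proj i).
Proof. by []. Qed.
Fact dprod_proj_monoid i : monoid_morphism (dprod_proj i).
Proof. by []. Qed.
HB.instance Definition _ i := GRing.isZmodMorphism.Build (dprod B) (B i) (dprod_proj i) (dprod_proj_zmod i).
HB.instance Definition _ i :=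
  GRing.isMonoidMorphism.Build (dprod B) (B i) (dprod_proj i) (dprod_proj_monoid i).

Section Diagonal.
Variables (R : comPzRingType) (phi : forall i, {rmorphism R -> B i}).
Definition dprod_diag (r : R) : T := fun i => phi i r.
Fact dprod_diag_zmod : zmod_morphism dprod_diag.
Proof. by move=> r s; apply: ext => i; apply: rmorphB. Qed.
Fact dprod_diag_monoid : monoid_morphism dprod_diag.
Proof. by split=> [|r s]; apply: ext => i; [apply: rmorph1 | apply: rmorphM]. Qed.
HB.instance Definition _ := GRing.isZmodMorphism.Build R (dprod B) dprod_diag dprod_diag_zmod.
HB.instance Definition _ := GRing.isMonoidMorphism.Build R (dprod B) dprod_diag dprod_diag_monoid.
End Diagonal.
End ProductRing.

(** Membership in the row space of a matrix is tested against its cokernel, whose columns are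
    solutions [w] of the homogeneous system. *)
Lemma linear_alternative (K : fieldType) (k : nat) (T : eqType) (X : seq T)
    (A : 'I_k -> T -> K) (e : T -> K) : uniq X ->
  (forall w : T -> K, (forall i, \sum_(x <- X) A i x * w x = 0) ->
    \sum_(x <- X) e x * w x = 0) ->
  exists u : 'I_k -> K, forall x, x \in X -> e x = \sum_i u i * A i x.
Proof.
move=> Xu dual; pose X' := tnth (in_tuple X).
pose A' := \matrix_(i < k, j < size X) A i (X' j); pose e' := \row_(j < size X) e (X' j).
have : (e' <= A')%MS.
  rewrite submxE; apply/eqP/rowP => c; rewrite mxE [RHS]mxE.
  (* Column [c] of the cokernel, extended by zero outside [X]; as [X] has no repetitions, [index]
     recovers the position. *)
  pose w x := if insub (index x X) is Some j then cokermx A' j c else 0.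
  have wE j : w (X' j) = cokermx A' j c.
    rewrite /w; have -> : index (X' j) X = j.
      by rewrite /X' (tnth_nth (X' j)) index_uniq.
    by rewrite valK.
  transitivity (\sum_(x <- X) e x * w x).
    by rewrite [RHS]big_tnth; apply: eq_bigr => j _; rewrite wE; congr (_ * _); rewrite mxE.
  apply: dual => i; rewrite big_tnth.
  transitivity ((A' *m cokermx A') i c); last by rewrite mulmx_coker mxE.
  by rewrite mxE; apply: eq_bigr => j _; rewrite wE; congr (_ * _); rewrite mxE.
case/submxP => D eE; exists (fun i => D 0 i) => x xX.
have jX : (index x X < size X)%N by rewrite index_mem.
have := congr1 (fun N : 'rV_(size X) => N 0 (Ordinal jX)) eE.
have xE : X' (Ordinal jX) = x by rewrite /X' (tnth_nth x) /= nth_index.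
by rewrite !mxE xE => ->; apply: eq_bigr => i _; rewrite !mxE xE.
Qed.

Section Compactness.
Variables (R : comPzRingType) (M : lmodType R) (N : submodClosed M) (m : M).

(** A list of coefficients and vectors, read as a linear relation in [M / N]; in [satisfies] the
    vectors act as unknowns. *)
Definition relation (c : seq (R * M)) : Prop := \sum_(t <- c) t.1 *: t.2 \in N.

Definition satisfies (K : comPzRingType) (phi : {rmorphism R -> K}) (w : M -> K)
  (c : seq (R * M)) : Prop := \sum_(t <- c) phi t.1 * w t.2 = 0.

(* Otherwise every finite set of relations is satisfied over some field by a [w] with
   [w m = 1], and a residue field of the product of these fields, at a prime containing
   the elements which vanish on all sufficiently large sets of relations, carries an
   [R]-linear form killing [N] but not [m]. *)
Lemma radical_finite_obstruction : radical N m ->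
  exists s : seq (seq (R * M)), (forall c, c \in s -> relation c) /\
    forall (K : fieldType) (phi : {rmorphism R -> K}) (w : M -> K),
      w m = 1 -> ~ (forall c, c \in s -> satisfies phi w c).
Proof.
move=> /radicalP radN; apply: contrapT => noobs.
pose I := {s : seq (seq (R * M)) | forall c, c \in s -> relation c}.
have sol (s : I) : exists k : {K : fieldType & ({rmorphism R -> K} * (M -> K))%type},
    (projT2 k).2 m = 1 /\
    forall c, c \in sval s -> satisfies (projT2 k).1 (projT2 k).2 c.
  apply: contrapT => nosol; apply: noobs; exists (sval s); split; first exact: (svalP s).
  by move=> K phi w wm wsat; apply: nosol; exists (existT _ K (phi, w)).
pose k s := projT1 (cid (sol s)).
have km s : (projT2 (k s)).2 m = 1 := (projT2 (cid (sol s))).1.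
have ksat s : forall c, c \in sval s -> satisfies (projT2 (k s)).1 (projT2 (k s)).2 c
  := (projT2 (cid (sol s))).2.
pose B := dprod (fun s : I => projT1 (k s) : comPzRingType).
pose diag : {rmorphism R -> B} := dprod_diag (fun s : I => (projT2 (k s)).1).
pose J (b : B) := exists s0 : I, forall s : I, {subset sval s0 <= sval s} -> b s = 0.
have nilP : forall c : seq (R * M), c \in [::] -> relation c by [].
have JI : is_ideal J.
  split=> [|b b' [s sP] [s' sP']|a b [s sP]].
  - by exists (exist _ [::] nilP).
  - have ss'P c : c \in sval s ++ sval s' -> relation c.
      by rewrite mem_cat => /orP[]; [apply: (svalP s) | apply: (svalP s')].
    exists (exist _ _ ss'P) => t /= tP; rewrite -[LHS]/(b t + b' t).
    rewrite sP ?sP' ?addr0 // => c cs; apply: tP; rewrite mem_cat cs ?orbT //.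
  - by exists s => t tP; rewrite -[LHS]/(a t * b t) sP ?mulr0.
have J1 : ~ J 1.
  by move=> [s /(_ s (fun _ h => h))]; apply/eqP/oner_neq0.
have [p [pP JP]] := exists_prime_ideal JI J1.
have [K [q qE]] := residue_field pP.
pose w x := q ((fun s => (projT2 (k s)).2 x) : B).
suff /radN : annihilating_functional N (q \o diag) w.
  rewrite /w (_ : (fun=> _) = (1 : B)) ?rmorph1; first by apply/eqP/oner_neq0.
  exact: dprod_ext.
have wsat c : relation c -> satisfies (q \o diag) w c.
  move=> cN; rewrite /satisfies.
  have -> : \sum_(t <- c) (q \o diag) t.1 * w t.2 =
      q ((fun s => \sum_(t <- c) (projT2 (k s)).1 t.1 * (projT2 (k s)).2 t.2) : B).
    elim: c {cN} => [|t c IH].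
      by rewrite big_nil -(rmorph0 q); congr (q _); apply: dprod_ext => s; rewrite big_nil.
    rewrite big_cons IH /w /= -rmorphM -rmorphD; congr (q _).
    by apply: dprod_ext => s; rewrite big_cons.
  apply/qE/JP.
  (* As soon as a finite set of relations contains [c], its chosen solution satisfies [c]. *)
  have cP d : d \in [:: c] -> relation d by rewrite inE => /eqP ->.
  exists (exist _ _ cP) => s /= cs; apply: ksat; apply: cs; exact: mem_head.
(* Additivity, semilinearity and vanishing on [N] are each instances of a single linear relation in
   [M / N]. *)
split=> [x y|a x|x xN].
- have := wsat [:: (1, x + y); (-1, x); (-1, y)].
  rewrite /relation /satisfies !big_cons !big_nil /= !addr0 !scale1r !scaleN1r.
  rewrite !rmorphN !rmorph1 !mul1r !mulN1r -opprD subrr => /(_ (rpred0 N)) /eqP.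
  by rewrite -opprD subr_eq0 => /eqP.
- have := wsat [:: (1, a *: x); (-a, x)].
  rewrite /relation /satisfies !big_cons !big_nil /= !addr0 !scale1r scaleNr.
  rewrite !rmorphN !rmorph1 !mul1r !mulNr subrr => /(_ (rpred0 N)) /eqP.
  by rewrite subr_eq0 => /eqP.
- have := wsat [:: (1, x)].
  rewrite /relation /satisfies !big_cons !big_nil /= !addr0 scale1r !rmorph1 mul1r.
  exact.
Qed.
End Compactness.

(* The cover is generated by the solutions inside the product of the residue fields of
   [R]; its projection to each factor gives the prime lying over the given one. *)
Lemma pointwise_solution (R : comPzRingType) (k : nat) (T : eqType) (X : seq T)
    (A : 'I_k -> T -> R) (e : T -> R) :
  (forall (K : fieldType) (phi : {rmorphism R -> K}),
    exists u : 'I_k -> K, forall x, x \in X -> phi (e x) = \sum_i u i * phi (A i x)) ->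
  exists (V : comPzRingType) (f : {rmorphism R -> V}) (u : 'I_k -> V),
    [/\ Spec_surjective f, finite_type f &
        forall x, x \in X -> f (e x) = \sum_i u i * f (A i x)].
Proof.
move=> sol; pose P := {p : R -> Prop | is_prime_ideal p}.
have res (p : P) : exists k : {K : fieldType & {rmorphism R -> K}},
    forall r, projT2 k r = 0 <-> sval p r.
  by have [K [phi phiE]] := residue_field (svalP p); exists (existT _ K phi).
pose kappa p := projT1 (cid (res p)).
have kappaE p : forall r, projT2 (kappa p) r = 0 <-> sval p r := projT2 (cid (res p)).
pose u (p : P) := projT1 (cid (sol _ (projT2 (kappa p)))).
have uE p : forall x, x \in X ->
    projT2 (kappa p) (e x) = \sum_i u p i * projT2 (kappa p) (A i x)
  := projT2 (cid (sol _ (projT2 (kappa p)))).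
pose B := dprod (fun p : P => projT1 (kappa p) : comPzRingType).
pose diag : {rmorphism R -> B} := dprod_diag (fun p : P => projT2 (kappa p)).
(* [v i] collects the [i]-th coefficients of the solutions at all primes; these elements generate
   the cover. *)
pose v i : B := fun p => u p i; pose t := codom v.
have vt i : v i \in gen_pred diag t by apply/gen_pred_gen/codom_f.
exists (gen_alg diag t), (gen_str diag t), (fun i => GenAlg (vt i)).
split; [|exact: gen_str_finite_type|] => [p pP|x xX].
  pose y := @dprod_proj P _ (exist _ p pP) \o (val : {rmorphism gen_alg diag t -> B}).
  exists (fun z => y z = 0); split; first exact: (field_kernel_prime y).
  by move=> r; apply: (kappaE (exist _ p pP)).
apply: val_inj; rewrite rmorph_sum /=; apply: dprod_ext => p.
rewrite -[RHS]/(dprod_proj p _) rmorph_sum.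
by rewrite [LHS]uE.
Qed.

(** By the finite obstruction, the coordinate of [m] is over every field a combination of the chosen
    relations. A cover carries such coefficients [u], and there [m (x) 1] is the combination of
    elements of [N] with these coefficients. *)
Lemma radical_surjective_closure (R : comPzRingType) (ft : bool) (M : lmodType R)
    (N : submodClosed M) (m : M) : radical N m -> surjective_closure ft N m.
Proof.
move=> radN; have [s [srel sobs]] := radical_finite_obstruction radN.
pose X := undup (m :: [seq t.2 | t <- flatten s]).
have Xu : uniq X := undup_uniq _.
have mX : m \in X by rewrite mem_undup mem_head.
have sX c t : c \in s -> t \in c -> t.2 \in X.
  move=> cs tc; rewrite mem_undup inE map_f ?orbT //.
  by apply/flattenP; exists c.
pose k := size s; pose rel_ (i : 'I_k) := tnth (in_tuple s) i.
have rel_s i : rel_ i \in s by exact: mem_tnth.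
(* A vector may occur several times in a relation, so its coefficients are added up. *)
pose A (i : 'I_k) x := \sum_(t <- rel_ i | t.2 == x) t.1; pose e x : R := (x == m)%:R.
(* Regrouping a relation by its distinct vectors, for any expression additive in the coefficient. *)
have AE (G : zmodType) (F : R -> M -> G) i : (forall x, {morph F^~ x : a b / a + b}) ->
    (forall x, F 0 x = 0) -> \sum_(x <- X) F (A i x) x = \sum_(t <- rel_ i) F t.1 t.2.
  move=> FD F0.
  transitivity (\sum_(x <- X) \sum_(t <- rel_ i | t.2 == x) F t.1 x).
    by apply: eq_bigr => x _; apply: (big_morph (F^~ x)).
  rewrite (exchange_big_dep predT) //=; apply: eq_big_seq => t ti.
  rewrite -big_filter (perm_big [:: t.2]) ?big_seq1 //.
  rewrite uniq_perm ?filter_uniq // => x; rewrite mem_filter inE eq_sym.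
  by case: eqP => //= ->; rewrite (sX (rel_ i)).
have eE (G : zmodType) (F : R -> M -> G) : (forall x, F 0 x = 0) ->
    \sum_(x <- X) F (e x) x = F 1 m.
  move=> F0; rewrite (bigD1_seq m) //= /e eqxx big1 ?addr0 // => x /negPf ->.
  exact: F0.
have [K phi|V [f [u [fS fF uE]]]] := @pointwise_solution R k M X A e.
  (* A solution [w] with [w m] nonzero could be scaled to value 1 at [m], which the obstruction
     excludes. *)
  apply: (linear_alternative (e := phi \o e)) => // w wA; apply: contrapT => /eqP we.
  rewrite (eE _ (fun a x => phi a * w x)) in we; last by move=> x; rewrite rmorph0 mul0r.
  rewrite rmorph1 mul1r in we.
  apply: (sobs K phi (fun x => w x / w m)); first by rewrite divff.
  move=> c /(tnthP (in_tuple s)) [i ->]; rewrite /satisfies.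
  under eq_bigr => t _ do rewrite mulrA.
  rewrite -mulr_suml -/(rel_ i) -(AE _ (fun a x => phi a * w x)) ?wA ?mul0r //.
    by move=> x a b /=; rewrite rmorphD mulrDl.
  by move=> x; rewrite rmorph0 mul0r.
have nN i : \sum_(x <- X) A i x *: x \in N.
  rewrite (AE _ (fun a x => a *: x)); first exact: (srel _ (rel_s i)).
    by move=> x a b /=; rewrite scalerDl.
  by move=> x; rewrite scale0r.
apply: (cover_surjective_closure ft (z := \sum_i tpure f (Submod (nN i)) (u i)) fS fF).
rewrite (big_morph _ (@tensor_mapD _ _ _ (submod_incl N) _ f) (tensor_map0 (submod_incl N) f)).
(* Only [x = m] contributes to this sum, which gives [m (x) 1]; the equations for [u] turn it into
   the image of the chosen tensor. *)
transitivity (\sum_(x <- X) tpure f x (f (e x))); last first.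
  rewrite (eE _ (fun a x => tpure f x (f a))) ?rmorph1 // => x.
  by rewrite rmorph0 tpure0r.
transitivity (\sum_i \sum_(x <- X) tpure f x (u i * f (A i x))).
  apply: eq_bigr => i _; rewrite tensor_map_pure tpure_suml.
  by apply: eq_bigr => x _; rewrite tpureZ mulrC.
rewrite exchange_big; apply: eq_big_seq => x xX.
by rewrite uE // tpure_sumr.
Qed.

Lemma radical_surjective_closureP (R : comPzRingType) (ft : bool) (M : lmodType R)
    (N : submodClosed M) (m : M) : radical N m <-> surjective_closure ft N m.
Proof.
by split; [exact: radical_surjective_closure | exact: surjective_closure_radical].
Qed.

(* [ft] selects the site: all schemes affine over Spec R (ft = false), or those
   of finite type over Spec R (ft = true). *)
Theorem proposition3p2p3 (R : comPzRingType) (ft : bool) :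
  (forall (M : lmodType R) (N : submodClosed M),
      finitely_presented (quotmod N) ->
      forall m : M, radical N m <-> surjective_closure ft N m) /\
  (noetherian R -> finite_dimensional R ->
    forall (M : lmodType R) (N : submodClosed M) (m : M),
      radical N m <-> surjective_closure ft N m).
Proof.
by split=> [M N _ m|_ _ M N m]; exact: radical_surjective_closureP.
Qed.
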